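(* Let $(\sigma,V^{(1)},V^{(2)})$ and $(\sigma',V^{(1)'},V^{(2)'})$ be two pure isometric covariant representations of the product system $\mathbb E$ over $\mathbb N_0^2$ on Hilbert spaces $\mathcal H$ and $\mathcal H'$, respectively. Then $(\sigma,V^{(1)},V^{(2)})$ and $(\sigma',V^{(1)'},V^{(2)'})$ are isomorphic if and only if the triples $$\big(\sigma|_{\mathcal W},\ \widetilde V^{(1)}|_{E_1\otimes\mathcal W_2},\ I_{E_1}\otimes\widetilde V^{(2)*}|_{\widetilde V^{(2)}(E_2\otimes\mathcal W_1)}\big)\quad\text{and}\quad\big(\sigma'|_{\mathcal W'},\ \widetilde V^{(1)'}|_{E_1\otimes\mathcal W_2'},\ I_{E_1}\otimes\widetilde V^{(2)'*}|_{\widetilde V^{(2)'}(E_2\otimes\mathcal W_1')}\big)$$ are isomorphic.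
   Context: All $*$-homomorphisms and representations are nondegenerate. A $C^*$-correspondence over a $C^*$-algebra $\mathcal A$ is a Hilbert $\mathcal A$-module $F$ with a left action of $\mathcal A$ given by a $*$-homomorphism into the adjointable operators on $F$. Tensor products are interior tensor products, and for a representation $\sigma$ of $\mathcal A$ on a Hilbert space $\mathcal H$, $F\otimes\mathcal H=F\otimes_\sigma\mathcal H$ has inner product $\langle\xi_1\otimes h_1,\xi_2\otimes h_2\rangle=\langle h_1,\sigma(\langle\xi_1,\xi_2\rangle)h_2\rangle$. A (completely bounded) covariant representation of $F$ on $\mathcal H$ is a pair $(\sigma,V)$ with $\sigma:\mathcal A\to B(\mathcal H)$ a representation and $V:F\to B(\mathcal H)$ linear, completely bounded, with $V(b\xi a)=\sigma(b)V(\xi)\sigma(a)$. Put $\widetilde V:F\otimes\mathcal H\to\mathcal H$, $\widetilde V(\xi\otimes h)=V(\xi)h$, and $\widetilde V_n(\xi_1\otimes\cdots\otimes\xi_n\otimes h)=V(\xi_1)\cdots V(\xi_n)h$ on $F^{\otimes n}\otimes\mathcal H$. It is isometric if $V(\eta)^*V(\xi)=\sigma(\langle\eta,\xi\rangle)$ (equivalently $\widetilde V$ is an isometry), and pure if $\widetilde V_n\widetilde V_n^*\to0$ strongly. A product system $\mathbb E$ over $\mathbb N_0^2$ consists of $C^*$-correspondences $E_1,E_2$ over $\mathcal A$ and a unitary isomorphism $t_{2,1}:E_2\otimes E_1\to E_1\otimes E_2$; $t_{1,2}=t_{2,1}^{-1}$, $E:=E_1\otimes E_2$. A covariant representation of $\mathbb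 E$ on $\mathcal H$ is a triple $(\sigma,V^{(1)},V^{(2)})$ where each $(\sigma,V^{(i)})$ is a covariant representation of $E_i$ and $\widetilde V^{(1)}(I_{E_1}\otimes\widetilde V^{(2)})=\widetilde V^{(2)}(I_{E_2}\otimes\widetilde V^{(1)})(t_{1,2}\otimes I_{\mathcal H})$; it is isometric if both $(\sigma,V^{(i)})$ are. Then $\widetilde V:=\widetilde V^{(1)}(I_{E_1}\otimes\widetilde V^{(2)})$ defines an isometric covariant representation $(\sigma,V)$ of $E$, and the triple is called pure if $(\sigma,V)$ is pure. Put $\mathcal W=\mathcal H\ominus\widetilde V(E\otimes\mathcal H)$ and $\mathcal W_i=\mathcal H\ominus\widetilde V^{(i)}(E_i\otimes\mathcal H)$ (all $\sigma$-invariant); one has $\mathcal W=\mathcal W_1\oplus\widetilde V^{(1)}(E_1\otimes\mathcal W_2)=\widetilde V^{(2)}(E_2\otimes\mathcal W_1)\oplus\mathcal W_2$. The spaces $\mathcal W',\mathcal W_i'$ are defined in the same way from $(\sigma',V^{(1)'},V^{(2)'})$. Two covariant representations $(\sigma,V^{(1)},V^{(2)})$ on $\mathcal H$ and $(\sigma',V^{(1)'},V^{(2)'})$ on $\mathcal H'$ are isomorphic if there is a unitary $U:\mathcal H\to\mathcal H'$ with $U\sigma(a)=\sigma'(a)U$ and $V^{(i)'}(\xi_i)U=UV^{(i)}(\xi_i)$ for all $a\in\mathcal A$, $\xi_i\in E_i$, $i=1,2$. Isomorphism of the two triples in the claim means: putting $\psi_1=\widetilde V^{(2)*}|_{\widetilde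 V^{(2)}(E_2\otimes\mathcal W_1)}$, $\psi_2=\widetilde V^{(1)}|_{E_1\otimes\mathcal W_2}$ and $\psi_1'=\widetilde V^{(2)'*}|_{\widetilde V^{(2)'}(E_2\otimes\mathcal W_1')}$, $\psi_2'=\widetilde V^{(1)'}|_{E_1\otimes\mathcal W_2'}$, there exists a unitary $X:\mathcal W\to\mathcal W'$ (mapping $\widetilde V^{(2)}(E_2\otimes\mathcal W_1)$ into $\widetilde V^{(2)'}(E_2\otimes\mathcal W_1')$ and $\mathcal W_2$ into $\mathcal W_2'$, so that the following make sense) such that $X\sigma(a)|_{\mathcal W}=\sigma'(a)X$ for $a\in\mathcal A$, $(I_{E_2}\otimes X)\psi_1=\psi_1'X$ and $X\psi_2=\psi_2'(I_{E_1}\otimes X)$. *)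

(* Defs.v *)
From HB Require Import structures.
From mathcomp Require Import all_boot all_order all_algebra.
From mathcomp Require Import all_classical all_reals all_analysis.
From mathcomp Require Import complex.

Set Implicit Arguments.
Unset Strict Implicit.
Unset Printing Implicit Defensive.

Import Order.TTheory GRing.Theory Num.Theory.
Import numFieldNormedType.Exports.

Local Open Scope classical_set_scope.
Local Open Scope ring_scope.
Local Open Scope complex_scope.

Section ComplexComplete.
Variable R : realType.
Implicit Types (z : R[i]).

Let norm_Im z : `|complex.Im z|%:C <= `|z|.
Proof.
case: z => a b; rewrite normc_def /= lecR -[`|b|]sqrtr_sqr.
by rewrite ler_wsqrtr ?sqrtr_sqr ?real_normK ?num_real ?lerDr ?sqr_ge0.
Qed.

Let norm_le_part z : `|z| <= (`|complex.Re z| + `|complex.Im z|)%:C.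
Proof.
case: z => a b; rewrite normc_def /= lecR.
rewrite -[leRHS]ger0_norm ?addr_ge0// -sqrtr_sqr ler_wsqrtr// sqrrD.
by rewrite !real_normK ?num_real// addrAC lerDl mulrn_wge0// mulr_ge0.
Qed.

Let cauchy_part (f : R[i]^o -> R^o) (F : set_system R[i]^o) :
    (forall z w : R[i]^o, f (z - w) = f z - f w) ->
    (forall z : R[i]^o, `|f z : R|%:C <= `|z|) ->
  ProperFilter F -> cauchy F -> cvg (f @ F).
Proof.
move=> fB fn FF /cauchy_ballP Fc; apply/cauchy_cvgP/cauchy_ballP => e e0.
have H (z w : R[i]^o) : ball z e%:C w -> ball (f z) e (f w).
  rewrite -!ball_normE /ball_ /= => h.
  by rewrite -fB -ltcR; exact: le_lt_trans (fn _) h.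
by rewrite near_map2; near do apply: H; apply: Fc; rewrite ltcR.
Unshelve. all: by end_near. Qed.

Lemma complex_complete (F : set_system R[i]^o) :
  ProperFilter F -> cauchy F -> cvg F.
Proof.
move=> FF Fc.
have ReB (z w : R[i]^o) : complex.Re (z - w) = complex.Re z - complex.Re w.
  by case: z w => [? ?] [? ?].
have ImB (z w : R[i]^o) : complex.Im (z - w) = complex.Im z - complex.Im w.
  by case: z w => [? ?] [? ?].
have /cvg_ex[a /cvgrPdist_lt Fa] : cvg ((@complex.Re R : R[i]^o -> R^o) @ F).
  by apply: cauchy_part => // z; exact: normc_ge_Re.
have /cvg_ex[b /cvgrPdist_lt Fb] : cvg ((@complex.Im R : R[i]^o -> R^o) @ F).
  exact: cauchy_part.
apply/cvg_ex; exists (a +i* b); apply/cvgrPdist_lt => e.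
case: e => e e'; rewrite ltcE /= => /andP[/eqP -> e0].
have e20 : 0 < e / 2 by rewrite divr_gt0.
near=> z.
apply: le_lt_trans (norm_le_part _) _.
rewrite ltcR ReB ImB /= [ltRHS]splitr.
by apply: ltrD; near: z; [exact: Fa|exact: Fb].
Unshelve. all: by end_near. Qed.

End ComplexComplete.

(* The complex line as a Banach space over itself.  The alias is needed because
   the canonical complete structure of [_^o] is already taken by [realType]. *)
Definition cline (R : realType) : Type := R[i]^o.
HB.instance Definition _ (R : realType) := NormedModule.copy (cline R) R[i]^o.
HB.instance Definition _ (R : realType) :=
  Uniform_isComplete.Build (cline R) (@complex_complete R).

Local Close Scope complex_scope.

Section Operators.
Variable R : realType.
Implicit Types K L : completeNormedModType R[i].

Definition lspan K (S : set K) : set K :=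
  [set x | exists (n : nat) (c : 'I_n -> R[i]) (v : 'I_n -> K),
     (forall i, S (v i)) /\ x = \sum_i c i *: v i].

Definition total K (S : set K) : Prop := closure (lspan S) = setT.

Definition linear_on K L (D : set K) (f : K -> L) : Prop :=
  forall c x y, D x -> D y -> f (c *: x + y) = c *: f x + f y.

Definition bounded_linear_on K L (D : set K) (f : K -> L) : Prop :=
  linear_on D f /\ exists M : R[i], forall x, D x -> `|f x| <= M * `|x|.

(* The bounded operator on the subspace [D] with property [P]; it is only used
   for properties that prescribe the values on a set with dense span in [D].
   The values outside [D] are irrelevant. *)
Definition the_operator K L (D : set K) (P : (K -> L) -> Prop) : K -> L :=
  xget (fun=> 0) [set S | bounded_linear_on D S /\ P S].

End Operators.

Section CstarAlgebras.
Variable R : realType.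

(* C*-algebras are not assumed to be unital.  The norm takes values in [R[i]],
   as for every normed module over [R[i]]. *)
Record cstarAlgebra := CstarAlgebra {
  cstar_sort :> completeNormedModType R[i];
  cmul : cstar_sort -> cstar_sort -> cstar_sort;
  cstar : cstar_sort -> cstar_sort;
  cmulA : forall a b c, cmul a (cmul b c) = cmul (cmul a b) c;
  cmul_linearl : forall k a b c, cmul (k *: a + b) c = k *: cmul a c + cmul b c;
  cmul_linearr : forall k a b c, cmul a (k *: b + c) = k *: cmul a b + cmul a c;
  cstar_semilinear : forall k a b, cstar (k *: a + b) = k^* *: cstar a + cstar b;
  cstarK : forall a, cstar (cstar a) = a;
  cstarM : forall a b, cstar (cmul a b) = cmul (cstar b) (cstar a);
  cnormM : forall a b, `|cmul a b| <= `|a| * `|b|;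
  cnorm_star : forall a, `|cmul (cstar a) a| = `|a| ^+ 2 }.

(* Hilbert modules: the inner product is linear in the second variable. *)
Record hilbertModule (A : cstarAlgebra) := HilbertModule {
  hilbert_sort :> completeNormedModType R[i];
  ract : hilbert_sort -> A -> hilbert_sort;
  inner : hilbert_sort -> hilbert_sort -> A;
  ractA : forall x a b, ract (ract x a) b = ract x (cmul a b);
  ract_linearl : forall k x y a, ract (k *: x + y) a = k *: ract x a + ract y a;
  ract_linearr : forall k x a b, ract x (k *: a + b) = k *: ract x a + ract x b;
  inner_linear : forall k x y z,
    inner x (k *: y + z) = k *: inner x y + inner x z;
  inner_ract : forall x y a, inner x (ract y a) = cmul (inner x y) a;
  inner_star : forall x y, cstar (inner x y) = inner y x;
  inner_pos : forall x, exists b, inner x x = cmul (cstar b) b;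
  inner_norm : forall x, `|x| ^+ 2 = `|inner x x| }.

(* An A-B-correspondence: a Hilbert B-module with a nondegenerate left action of
   A.  [lact_adj] says that [lact a] is adjointable with adjoint
   [lact (cstar a)], which entails that it is linear and bounded. *)
Record correspondence (A B : cstarAlgebra) := Correspondence {
  corr_module :> hilbertModule B;
  lact : A -> corr_module -> corr_module;
  lact_linear : forall k a b x, lact (k *: a + b) x = k *: lact a x + lact b x;
  lactM : forall a b x, lact (cmul a b) x = lact a (lact b x);
  lact_adj : forall a x y, inner (lact a x) y = inner x (lact (cstar a) y);
  lact_nondegenerate : total [set lact a x | a in setT & x in setT] }.

Definition complex_mul (x y : cline R) : cline R := (x : R[i]) * (y : R[i]).

Definition complex_conj (x : cline R) : cline R := (x : R[i])^*.

Lemma complex_mulA a b c :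
  complex_mul a (complex_mul b c) = complex_mul (complex_mul a b) c.
Proof. exact: mulrA. Qed.

Lemma complex_mul_linearl (k : R[i]) (a b c : cline R) :
  complex_mul (k *: a + b) c = k *: complex_mul a c + complex_mul b c.
Proof. by rewrite /complex_mul [LHS]mulrDl -[in LHS]mulrA. Qed.

Lemma complex_mul_linearr (k : R[i]) (a b c : cline R) :
  complex_mul a (k *: b + c) = k *: complex_mul a b + complex_mul a c.
Proof. by rewrite /complex_mul [LHS]mulrDr [in LHS]mulrCA. Qed.

Lemma complex_conj_semilinear (k : R[i]) (a b : cline R) :
  complex_conj (k *: a + b) = k^* *: complex_conj a + complex_conj b.
Proof. by rewrite /complex_conj [LHS]rmorphD [in LHS]rmorphM. Qed.

Lemma complex_conjK a : complex_conj (complex_conj a) = a.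
Proof. exact: conjCK. Qed.

Lemma complex_conjM a b :
  complex_conj (complex_mul a b) = complex_mul (complex_conj b) (complex_conj a).
Proof. by rewrite /complex_conj /complex_mul [LHS]rmorphM mulrC. Qed.

Lemma complex_normM (a b : cline R) : `|complex_mul a b| <= `|a| * `|b|.
Proof. by rewrite [leLHS]normrM. Qed.

Lemma complex_norm_conj (a : cline R) :
  `|complex_mul (complex_conj a) a| = `|a| ^+ 2.
Proof. by rewrite [LHS]normrM norm_conjC expr2. Qed.

Definition complex_cstar : cstarAlgebra :=
  CstarAlgebra complex_mulA complex_mul_linearl complex_mul_linearr
    complex_conj_semilinear complex_conjK complex_conjM complex_normM
    complex_norm_conj.

End CstarAlgebras.

(* Hilbert spaces are Hilbert modules over the complex numbers, and a
   (nondegenerate) representation of A on a Hilbert space [H] is an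
   A-C-correspondence with underlying module [H]: sigma(a)h is [lact a h]. *)
Notation hilbertSpace R := (hilbertModule (complex_cstar R)).
Notation representation A := (correspondence A (complex_cstar _)).

Section TensorProducts.
Variable R : realType.

(* The interior tensor product is determined up to a unique unitary by the inner
   products of elementary tensors and their totality.  Definiteness of the inner
   product forces [tens] to be bilinear, balanced and compatible with the right
   actions. *)
Record interior_tensor (A B D : cstarAlgebra R) (F : correspondence A B)
    (G : correspondence B D) := InteriorTensor {
  tens_corr :> correspondence A D;
  tens : F -> G -> tens_corr;
  tens_inner : forall x y g h,
    inner (tens x g) (tens y h) = inner g (lact (inner x y) h);
  tens_total : total [set tens x g | x in setT & g in setT];
  tens_lact : forall a x g, lact a (tens x g) = tens (lact a x) g }.

(* A choice of a model of each interior tensor product.  Models exist (complete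
   the algebraic tensor product) and are canonically isomorphic, so nothing
   depends on the choice. *)
Definition tensor_products := forall (A B D : cstarAlgebra R)
  (F : correspondence A B) (G : correspondence B D), interior_tensor F G.

Definition tensor (T : tensor_products) A B D (F : correspondence A B)
  (G : correspondence B D) : correspondence A D := T A B D F G.

Definition etensor (T : tensor_products) A B D (F : correspondence A B)
  (G : correspondence B D) (x : F) (g : G) : tensor T F G := tens (T A B D F G) x g.

End TensorProducts.

Section ProductSystems.
Variables (R : realType) (T : tensor_products R) (A : cstarAlgebra R).
Local Notation "F \OX G" := (tensor T F G) (at level 40, left associativity).

Definition unitary_corr (F G : correspondence A A) (U : F -> G) : Prop :=
  [/\ linear_on setT U, forall x y, inner (U x) (U y) = inner x y,
      forall a x b, U (ract (lact a x) b) = ract (lact a (U x)) b &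
      range U = setT].

Record product_system := ProductSystem {
  ps1 : correspondence A A;
  ps2 : correspondence A A;
  t21 : ps2 \OX ps1 -> ps1 \OX ps2;
  t12 : ps1 \OX ps2 -> ps2 \OX ps1;
  t21_unitary : unitary_corr t21;
  t21K : cancel t21 t12;
  t12K : cancel t12 t21 }.

End ProductSystems.

Section Representations.
Variables (R : realType) (T : tensor_products R) (A : cstarAlgebra R).
Local Notation "F \OX G" := (tensor T F G) (at level 40, left associativity).
Local Notation "x \ox g" := (etensor T x g) (at level 40, left associativity).

Definition adjoint (H K : hilbertSpace R) (S : H -> K) : K -> H :=
  xget (fun=> 0) [set S' | forall x y, inner (S x) y = inner x (S' y)].

Definition unitary_on (H K : hilbertSpace R) (D : set H) (D' : set K)
    (X : H -> K) : Prop :=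
  [/\ linear_on D X, forall x y, D x -> D y -> inner (X x) (X y) = inner x y &
      X @` D = D'].

(* F (x) D, for a subspace D of G, as a closed subspace of F (x) G *)
Definition tensor_sub (B D : cstarAlgebra R) (F : correspondence A B)
    (G : correspondence B D) (W : set G) : set (F \OX G) :=
  closure (lspan [set x \ox g | x in setT & g in W]).

Arguments tensor_sub {B D} F {G} W.

(* I_F (x) X : F (x) W -> F (x) K, for X defined on the subspace W of H *)
Definition id_tensor (F : correspondence A A) (H K : representation A)
    (W : set H) (X : H -> K) : F \OX H -> F \OX K :=
  the_operator (tensor_sub F W)
    (fun S => forall x h, W h -> S (x \ox h) = x \ox X h).

Definition tensor_id (F G : correspondence A A) (H : representation A)
    (U : F -> G) : F \OX H -> G \OX H :=
  the_operator setT (fun S => forall x h, S (x \ox h) = U x \ox h).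

(* the identification of (F (x) G) (x) H with F (x) (G (x) H) *)
Definition tensorA (F G : correspondence A A) (H : representation A) :
    F \OX G \OX H -> F \OX (G \OX H) :=
  the_operator setT
    (fun S => forall x y h, S (x \ox y \ox h) = x \ox (y \ox h)).

(* F^(n+1) (x) H is [tpow F n \OX H] *)
Fixpoint tpow (F : correspondence A A) (n : nat) : correspondence A A :=
  if n is n'.+1 then F \OX tpow F n' else F.

(* x 0 (x) ... (x) x n *)
Fixpoint etpow (F : correspondence A A) (n : nat) (x : nat -> F) : tpow F n :=
  match n return tpow F n with
  | 0%N => x 0%N
  | n'.+1 => x 0%N \ox etpow n' (fun i => x i.+1)
  end.

Section OneCorrespondence.
Variables (F : correspondence A A) (H : representation A) (V : F -> H -> H).

(* In the operator space structure that F inherits from its linking algebra, an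
   n x n matrix over F is normed as an operator from A^n to F^n, and one over
   B(H) as an operator on H^n.  [K] and [M] bound the squares of the norms. *)
Definition completely_bounded : Prop :=
  exists K : R[i], forall (n : nat) (x : 'I_n -> 'I_n -> F) (M : R[i]),
    0 <= M ->
    (forall a : 'I_n -> A,
       `|\sum_i inner (\sum_j ract (x i j) (a j)) (\sum_j ract (x i j) (a j))|
       <= M * `|\sum_j cmul (cstar (a j)) (a j)|) ->
    forall h : 'I_n -> H,
      `|\sum_i inner (\sum_j V (x i j) (h j)) (\sum_j V (x i j) (h j))|
      <= K * M * `|\sum_j inner (h j) (h j)|.

Definition covariant : Prop :=
  [/\ forall x, bounded_linear_on setT (V x),
      forall k x y h, V (k *: x + y) h = k *: V x h + V y h,
      forall a x b h, V (ract (lact b x) a) h = lact b (V x (lact a h)) &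
      completely_bounded].

Definition isometric : Prop :=
  forall x y h, adjoint (V y) (V x h) = lact (inner y x) h.

Definition tilde : F \OX H -> H :=
  the_operator setT (fun S => forall x h, S (x \ox h) = V x h).

(* V (x 0) ... V (x n) h *)
Fixpoint Vprod (n : nat) (x : nat -> F) (h : H) : H :=
  if n is n'.+1 then V (x 0%N) (Vprod n' (fun i => x i.+1) h) else V (x 0%N) h.

(* the operator on F^(n+1) (x) H *)
Definition tilde_pow (n : nat) : tpow F n \OX H -> H :=
  the_operator setT (fun S => forall x h, S (etpow n x \ox h) = Vprod n x h).

Definition pure : Prop :=
  forall h, (fun n => @tilde_pow n (adjoint (@tilde_pow n) h)) @ \oo --> (0 : H).

Definition wandering : set H :=
  [set h | forall z : F \OX H, inner (tilde z) h = 0].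

End OneCorrespondence.

Section ProductSystemRepresentations.
Variable E : product_system T A.
Local Notation E1 := (ps1 E).
Local Notation E2 := (ps2 E).

Section OneRepresentation.
Variables (H : representation A) (V1 : E1 -> H -> H) (V2 : E2 -> H -> H).

Definition ps_covariant : Prop :=
  [/\ covariant V1, covariant V2 &
      forall z : E1 \OX E2 \OX H,
        tilde V1 (id_tensor setT (tilde V2) (tensorA z)) =
        tilde V2 (id_tensor setT (tilde V1)
          (tensorA (tensor_id (@t12 _ _ _ E) z)))].

Definition ps_isometric : Prop :=
  [/\ ps_covariant, isometric V1 & isometric V2].

(* the representation of E1 (x) E2 given by tilde V1 (I (x) tilde V2) *)
Definition ps_product : E1 \OX E2 -> H -> H :=
  fun z h => tilde V1 (id_tensor setT (tilde V2) (tensorA (z \ox h))).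

Definition ps_pure : Prop := pure ps_product.

End OneRepresentation.

Section TwoRepresentations.
Variables (H H' : representation A).
Variables (V1 : E1 -> H -> H) (V2 : E2 -> H -> H).
Variables (V1' : E1 -> H' -> H') (V2' : E2 -> H' -> H').

Definition ps_isomorphic : Prop :=
  exists U : H -> H',
    [/\ unitary_on setT setT U,
        forall a h, U (lact a h) = lact a (U h),
        forall x h, V1' x (U h) = U (V1 x h) &
        forall x h, V2' x (U h) = U (V2 x h)].

Definition wandering_isomorphic : Prop :=
  let W := wandering (ps_product V1 V2) in
  let W' := wandering (ps_product V1' V2') in
  let W2 := wandering V2 in
  let W2' := wandering V2' in
  let Z := tilde V2 @` tensor_sub E2 (wandering V1) in
  let Z' := tilde V2' @` tensor_sub E2 (wandering V1') in
  exists X : H -> H',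
    [/\ unitary_on W W' X,
        X @` Z `<=` Z' /\ X @` W2 `<=` W2',
        forall a w, W w -> X (lact a w) = lact a (X w),
        forall z, Z z ->
          id_tensor W X (adjoint (tilde V2) z) = adjoint (tilde V2') (X z) &
        forall z, tensor_sub E1 W2 z ->
          X (tilde V1 z) = tilde V1' (id_tensor W X z)].

End TwoRepresentations.
End ProductSystemRepresentations.
End Representations.

(* Main.v *)
Require Import Defs.
From mathcomp Require Import all_boot all_order all_algebra.
From mathcomp Require Import all_classical all_reals all_analysis.
From mathcomp Require Import complex.
From mathcomp Require Import ring lra.

Set Implicit Arguments.
Unset Strict Implicit.
Unset Printing Implicit Defensive.

Import Order.TTheory GRing.Theory Num.Theory.
Import numFieldNormedType.Exports.

Local Open Scope classical_set_scope.
Local Open Scope ring_scope.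

Local Notation "x %:C" := (real_complex _ x) (format "x %:C") : ring_scope.

(** The equivalence rests on the Wold decomposition: if [(sigma, V)] is a pure
    isometric representation of [F] with wandering subspace [W], then [H] is the
    closed span of the vectors [V x1 (.. (V xn w))] with [w] in [W]
    ([pure_total]). The inner products of such vectors are determined by those
    of [W], by the action of the algebra on [W], and by the inner product of
    [F], because [V x] and [V y] satisfy [<V x h, V y k> = <h, sigma <x, y> k>].
    So a unitary [X : W -> W'] that commutes with the algebra extends to a
    unitary [U : H -> H'] with [U (V x h) = V' x (U h)]
    ([wandering_extension]). This is applied to the representation
    [prodrep V1 V2] of [E1 (x) E2].

    It remains to see that [U] intertwines [V1] and [V2] separately. On [W]
    this is what the two equations on the triples say: they give
    [U (V1 x w) = V1' x (U w)] for [w] in [W2] and [U (V2 y w) = V2' y (U w)]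
    for [w] in [W1]. As [W] is spanned by [W1] and [V1 E1 W2], and also by [W2]
    and [V2 E2 W1] ([wandering_prod_span]), and as [U] intertwines the products
    [V1 x V2 y] and [V2 y V1 x], both relations hold on [W]
    ([intertwine_wandering]). They propagate from a vector [g] to
    [V2 y (V1 x' g)], since [V1 x (V2 y (V1 x' g))] is the product
    representation at [x (x) y] applied to [V1 x' g] ([intertwine_step]); the commutation relation of the product
    system lets the products be taken in either order. Thus the relations hold
    on all of [H].

    Conversely, an isomorphism of the representations restricts to one of the
    wandering data.

    The rest provides the operator theory that this uses. Tensor products are
    known only through the inner products of elementary tensors and their
    totality, so each operator on them is obtained by extending an inner
    product preserving assignment on generators ([the_operator_extension]), and
    identities are checked on generators and extended by continuity
    ([bounded_linear_eq]). Adjoints come from the projection and Riesz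
    theorems. Continuity of [x |-> x (x) h] needs the boundedness of
    representations of a C*-algebra ([nm_lact]). *)

(** * Real-valued norms, closed spans and density arguments *)

Section RealNorm.
Variable R : realType.
Implicit Types V L : normedModType R[i].

(** The norm of a normed module over [R[i]] is a nonnegative real number seen
    as a complex one; [nm] is the real number itself, so that inequalities can
    be manipulated in the totally ordered field [R]. *)
Definition nm V (x : V) : R := complex.Re `|x|.

Lemma nmE V (x : V) : `|x| = (nm x)%:C.
Proof.
by rewrite /nm RRe_real// realE normr_ge0.
Qed.

Lemma nm_ge0 V (x : V) : 0 <= nm x.
Proof. by rewrite -ler0c -nmE. Qed.

Lemma nmD V (x y : V) : nm (x + y) <= nm x + nm y.
Proof. by rewrite -lecR rmorphD /= -!nmE ler_normD. Qed.

Lemma nmN V (x : V) : nm (- x) = nm x.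
Proof. by rewrite /nm normrN. Qed.

Lemma nmB V (x y : V) : nm (x - y) = nm (y - x).
Proof. by rewrite -nmN opprB. Qed.

Lemma nm_triangle V (y x z : V) : nm (x - z) <= nm (x - y) + nm (y - z).
Proof. by apply: le_trans (nmD _ _); rewrite addrA subrK. Qed.

Lemma nm0 V : nm (0 : V) = 0.
Proof. by rewrite /nm normr0. Qed.

Lemma nm_eq0 V (x : V) : nm x = 0 -> x = 0.
Proof. by move=> x0; apply/eqP; rewrite -normr_eq0 nmE x0. Qed.

Lemma nmZ V (c : R[i]) (x : V) : nm (c *: x) = complex.Re `|c| * nm x.
Proof. by apply: (@complexI R); rewrite rmorphM /= -!nmE normrZ (nmE (c : R[i]^o)). Qed.

Lemma nm_small V (x : V) : (forall e, 0 < e -> nm x <= e) -> x = 0.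
Proof.
move=> xe; apply: nm_eq0; apply/le_anti; rewrite nm_ge0 andbT.
by apply/ler_addgt0Pr => e /xe; rewrite add0r.
Qed.

Lemma ball_nm V (x y : V) (e : R) : ball x e%:C y <-> nm (x - y) < e.
Proof. by rewrite -ball_normE /ball_ /= nmE ltcR. Qed.

Lemma closure_nmP V (S : set V) x :
  closure S x <-> forall e, 0 < e -> exists2 y, S y & nm (x - y) < e.
Proof.
split=> [Sx e e0|Sx B /nbhs_ballP[[e e'] /=]].
  have [|y [Sy xy]] := Sx (ball x e%:C); first by apply: nbhsx_ballx; rewrite ltcR.
  by exists y => //; apply/ball_nm.
rewrite ltcE /= => /andP[/eqP -> e0] xB.
by have [y Sy xy] := Sx e e0; exists y; split => //; apply/xB/ball_nm.
Qed.

Lemma cvg_nmP V (u : nat -> V) l :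
  u @ \oo --> l <-> forall e, 0 < e -> exists N, forall n, (N <= n)%N -> nm (l - u n) < e.
Proof.
split=> [/cvgrPdist_lt ul e e0|ul].
  have [|N _ uN] := ul e%:C; first by rewrite ltcR.
  by exists N => n /uN; rewrite /= nmE ltcR.
apply/cvgrPdist_lt => -[e e']; rewrite ltcE /= => /andP[/eqP -> /ul[N uN]].
by exists N => // n /uN; rewrite /= nmE ltcR.
Qed.

Lemma cauchy_limit (V : completeNormedModType R[i]) (u : nat -> V) :
  (forall e, 0 < e -> exists N, forall n m, (N <= n)%N -> (N <= m)%N ->
     nm (u n - u m) < e) ->
  exists l, forall e, 0 < e -> exists N, forall n, (N <= n)%N -> nm (l - u n) < e.
Proof.
move=> uC; suff /cvg_ex[l ul] : cvg (u @ \oo) by exists l; apply/cvg_nmP.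
apply/cauchy_cvgP/cauchy_ballP => -[e e']; rewrite ltcE /= => /andP[/eqP -> /uC[N uN]].
rewrite near_map2; exists ([set n | N <= n]%N, [set n | N <= n]%N) => /=; first by split; exists N.
by case=> n m /= [Nn Nm]; apply/ball_nm; exact: uN.
Qed.

Lemma cauchy_limit_inv (V : completeNormedModType R[i]) (u : nat -> V) (C : R) :
  (forall n m, (n <= m)%N -> nm (u m - u n) <= C / n.+1%:R) ->
  exists l, forall e, 0 < e -> exists N, forall n, (N <= n)%N -> nm (l - u n) < e.
Proof.
move=> uC; apply: cauchy_limit => e e0.
have C0 : 0 <= C by have := uC 0%N 0%N isT; rewrite divr1; apply: le_trans; exact: nm_ge0.
have [N CN] : exists N, C / N.+1%:R < e.
  exists (Num.truncn (C / e)); rewrite ltr_pdivrMr ?ltr0n// mulrC -ltr_pdivrMr//.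
  by exact: truncnS_gt.
have le n m : (N <= n)%N -> (n <= m)%N -> nm (u m - u n) < e.
  move=> Nn nm'; apply: le_lt_trans (uC _ _ nm') _; apply: le_lt_trans CN.
  by rewrite ler_wpM2l// lef_pV2 ?posrE ?ltr0n// ler_nat.
exists N => n m Nn Nm; case: (leqP n m) => [nm'|/ltnW mn]; last exact: le.
by rewrite nmB; exact: le.
Qed.

Definition linear_subspace V (M : set V) : Prop :=
  M 0 /\ forall c x y, M x -> M y -> M (c *: x + y).

Lemma linear_subspaceB V (M : set V) x y : linear_subspace M -> M x -> M y -> M (x - y).
Proof. by move=> [_ M1] Mx My; rewrite addrC -scaleN1r; exact: M1. Qed.

Lemma linear_subspace_lspan (V : completeNormedModType R[i]) (S : set V) :
  linear_subspace (lspan S).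
Proof.
split; first by exists 0%N, (fun=> 0), (fun=> 0); split => [[]//|]; rewrite big_ord0.
move=> c x y [n [a [v [Sv ->]]]] [m [b [w [Sw ->]]]].
exists (n + m)%N, (fun i => match fintype.split i with inl i => c * a i | inr i => b i end),
  (fun i => match fintype.split i with inl i => v i | inr i => w i end).
split; first by move=> i; case: fintype.splitP.
rewrite big_split_ord /= scaler_sumr; congr (_ + _); apply: eq_bigr => i _.
  by rewrite -[lshift m i]/(unsplit (inl i)) unsplitK scalerA.
by rewrite -[rshift n i]/(unsplit (inr i)) unsplitK.
Qed.

Lemma sub_lspan (V : completeNormedModType R[i]) (S : set V) : S `<=` lspan S.
Proof.
move=> x Sx; exists 1%N, (fun=> 1), (fun=> x); split => //.
by rewrite big_ord1 scale1r.
Qed.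

Lemma lspan_min (V : completeNormedModType R[i]) (S M : set V) :
  linear_subspace M -> S `<=` M -> lspan S `<=` M.
Proof.
move=> [M0 M1] SM x [n [c [v [Sv ->]]]].
elim/big_ind: _ => [//|x1 x2 h1 h2|i _]; first by rewrite -[x1]scale1r; exact: M1.
by rewrite -[_ *: _]addr0; apply: M1 => //; apply: SM.
Qed.

Lemma linear_subspace_closure V (M : set V) : linear_subspace M -> linear_subspace (closure M).
Proof.
move=> [M0 M1]; split; first exact: subset_closure.
move=> c x y /closure_nmP Mx /closure_nmP My; apply/closure_nmP => e e0.
(* the summand 1 avoids a division by zero when [c = 0] *)
pose k := complex.Re `|c| + 1.
have k0 : 0 < k by rewrite ltr_wpDl// -[complex.Re _]/(nm (c : R[i]^o)) nm_ge0.
have [|x' Mx' xx'] := Mx (e / 2 / k); first by rewrite !divr_gt0.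
have [|y' My' yy'] := My (e / 2); first by rewrite divr_gt0.
exists (c *: x' + y'); first exact: M1.
rewrite opprD addrACA -scalerBr; apply: le_lt_trans (nmD _ _) _.
rewrite nmZ [ltRHS]splitr ler_ltD//.
move: xx'; rewrite ltr_pdivlMr// mulrC => /ltW; apply: le_trans.
by rewrite ler_wpM2r ?nm_ge0// lerDl.
Qed.

Lemma closure_lspan_subspace (V : completeNormedModType R[i]) (S : set V) :
  linear_subspace (closure (lspan S)).
Proof. exact/linear_subspace_closure/linear_subspace_lspan. Qed.

Lemma sub_closure_lspan (V : completeNormedModType R[i]) (S : set V) :
  S `<=` closure (lspan S).
Proof. by move=> x Sx; apply/subset_closure/sub_lspan. Qed.

Lemma closure_lspan_min (V : completeNormedModType R[i]) (S M : set V) :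
  linear_subspace M -> closed M -> S `<=` M -> closure (lspan S) `<=` M.
Proof.
by move=> M1 /closure_id Mc SM; rewrite Mc; apply: closureS; exact: lspan_min.
Qed.

Lemma closure_lspanS (V : completeNormedModType R[i]) (S S' : set V) :
  S `<=` S' -> closure (lspan S) `<=` closure (lspan S').
Proof.
move=> SS'; apply: closure_lspan_min; [exact: closure_lspan_subspace|exact: closed_closure|].
by move=> x /SS'; exact: sub_closure_lspan.
Qed.

Lemma linear_on0 (V L : completeNormedModType R[i]) (D : set V) (f : V -> L) :
  linear_subspace D -> linear_on D f -> f 0 = 0.
Proof.
move=> [D0 _] fl; have := fl (-1) 0 0 D0 D0.
by rewrite !scaleN1r !oppr0 add0r addNr.
Qed.

Lemma linear_onZ (V L : completeNormedModType R[i]) (D : set V) (f : V -> L) c x :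
  linear_subspace D -> linear_on D f -> D x -> f (c *: x) = c *: f x.
Proof.
move=> sD fl Dx; have := fl c x 0 Dx (proj1 sD).
by rewrite (linear_on0 sD fl) !addr0.
Qed.

Lemma linear_onB (V L : completeNormedModType R[i]) (D : set V) (f : V -> L) x y :
  linear_on D f -> D x -> D y -> f (x - y) = f x - f y.
Proof. by move=> fl Dx Dy; rewrite addrC -scaleN1r fl// scaleN1r addrC. Qed.

(** The bound in [bounded_linear_on] is a complex number without sign condition;
    its modulus is also a bound. *)
Lemma bounded_linear_nm (V L : completeNormedModType R[i]) (D : set V) (f : V -> L) :
  bounded_linear_on D f <->
  linear_on D f /\ exists2 M : R, 0 <= M & forall x, D x -> nm (f x) <= M * nm x.
Proof.
split=> -[fl]; [case=> M fM|case=> M _ fM]; split=> //.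
  exists (complex.Re `|M|); first by rewrite -ler0c -(nmE (M : R[i]^o)).
  move=> x Dx; rewrite -lecR rmorphM /= -(nmE (M : R[i]^o)) -!nmE.
  have fx := fM _ Dx; apply: le_trans (fx) _.
  by rewrite -(ger0_norm (le_trans (normr_ge0 (f x)) fx)) normrM normr_id.
by exists M%:C => x Dx; rewrite !nmE -rmorphM lecR; exact: fM.
Qed.

(** Most identities between operators below are proved on generators only and
    extended by this density argument. *)
Lemma bounded_linear_eq (V L : completeNormedModType R[i]) (D S : set V) (f g : V -> L) :
  D `<=` closure (lspan S) -> S `<=` D -> linear_subspace D ->
  bounded_linear_on D f -> bounded_linear_on D g ->
  (forall x, S x -> f x = g x) -> forall x, D x -> f x = g x.
Proof.
move=> DS SD sD /bounded_linear_nm[fl [M M0 fM]] /bounded_linear_nm[gl [N N0 gN]] fg x Dx.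
have fgS y : lspan S y -> f y = g y.
  move=> Sy; suff [] : D y /\ f y = g y by [].
  move: Sy; apply: (@lspan_min _ _ [set y | D y /\ f y = g y]) => [|z Sz]; last first.
    by split; [exact: SD|exact: fg].
  split; first by split; [exact: (proj1 sD)|rewrite !(linear_on0 sD)].
  move=> c y1 y2 [D1 e1] [D2 e2]; split; first exact: (proj2 sD).
  by rewrite fl// gl// e1 e2.
apply/eqP; rewrite -subr_eq0; apply/eqP/nm_small => e e0.
have MN : 0 < M + N + 1 by rewrite ltr_wpDl// addr_ge0.
have /closure_nmP/(_ (e / (M + N + 1)))[|y Sy xy] := DS _ Dx; first by rewrite divr_gt0.
have Dy : D y by move: Sy; exact: lspan_min.
have -> : f x - g x = f (x - y) - g (x - y).
  by rewrite (linear_onB fl)// (linear_onB gl)// (fgS _ Sy) opprB addrA subrK.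
apply: le_trans (nmD _ _) _; rewrite nmN.
have Dxy := linear_subspaceB sD Dx Dy.
apply: le_trans (lerD (fM _ Dxy) (gN _ Dxy)) _; rewrite -mulrDl.
move: xy; rewrite ltr_pdivlMr// => /ltW; apply: le_trans.
by rewrite mulrC ler_wpM2l ?nm_ge0// lerDl.
Qed.

Lemma bounded_linear_closure (V L : completeNormedModType R[i]) (D S : set V) (M : set L)
    (f : V -> L) :
  S `<=` D -> linear_subspace D -> bounded_linear_on D f -> linear_subspace M ->
  (forall x, S x -> M (f x)) -> forall x, D x -> closure (lspan S) x -> closure M (f x).
Proof.
move=> SD sD /bounded_linear_nm[fl [B B0 fB]] sM SM x Dx /closure_nmP Sx.
apply/closure_nmP => e e0; have B1 : 0 < B + 1 by rewrite ltr_wpDl.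
have [|y Sy xy] := Sx (e / (B + 1)); first by rewrite divr_gt0.
have [Dy My] : D y /\ M (f y).
  move: Sy; apply: (@lspan_min _ _ [set y | D y /\ M (f y)]) => [|z Sz]; last first.
    by split; [exact: SD|exact: SM].
  split; first by split; [exact: (proj1 sD)|rewrite (linear_on0 sD fl); exact: (proj1 sM)].
  move=> c y1 y2 [D1 e1] [D2 e2]; split; first exact: (proj2 sD).
  by rewrite fl//; exact: (proj2 sM).
exists (f y) => //; rewrite -(linear_onB fl)//.
apply: le_lt_trans (fB _ (linear_subspaceB sD Dx Dy)) _.
apply: le_lt_trans (_ : _ <= (B + 1) * nm (x - y)) _.
  by rewrite ler_wpM2r ?nm_ge0// lerDl.
by move: xy; rewrite ltr_pdivlMr// mulrC.
Qed.

Lemma total_bounded_linear_eq (V L : completeNormedModType R[i]) (S : set V) (f g : V -> L) :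
  Defs.total S -> bounded_linear_on setT f -> bounded_linear_on setT g ->
  (forall x, S x -> f x = g x) -> f =1 g.
Proof.
move=> ST fb gb fg x; apply: (@bounded_linear_eq _ _ setT S) => //.
by rewrite ST.
Qed.

Lemma bounded_linear_comp (V L K : completeNormedModType R[i]) (D : set V) (D' : set L)
    (f : V -> L) (g : L -> K) :
  (forall x, D x -> D' (f x)) ->
  bounded_linear_on D f -> bounded_linear_on D' g -> bounded_linear_on D (g \o f).
Proof.
move=> DD' /bounded_linear_nm[fl [M M0 fM]] /bounded_linear_nm[gl [N N0 gN]].
apply/bounded_linear_nm; split.
  by move=> k x y Dx Dy /=; rewrite fl// gl//; exact: DD'.
exists (N * M) => [|x Dx /=]; first by rewrite mulr_ge0.
by apply: le_trans (gN _ (DD' _ Dx)) _; rewrite -mulrA ler_wpM2l// fM.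
Qed.

Lemma bounded_linear_sub (V L : completeNormedModType R[i]) (D D' : set V) (f : V -> L) :
  D `<=` D' -> bounded_linear_on D' f -> bounded_linear_on D f.
Proof.
move=> DD' [fl [M fM]]; split; first by move=> c x y /DD' Dx /DD' Dy; exact: fl.
by exists M => x /DD'; exact: fM.
Qed.

Lemma linear_subspace_setT V : linear_subspace [set: V].
Proof. by []. Qed.

End RealNorm.

(** * Hilbert spaces: projections, the Riesz theorem, adjoints *)

Section HilbertSpaces.
Variable R : realType.
Implicit Types H K : hilbertSpace R.

(** Typing the inner product in [R[i]] rather than in [complex_cstar R] gives
    access to the field and order structures of the complex numbers. *)
Definition ip H (x y : H) : R[i] := inner x y.

Lemma ip_linear H c (x y z : H) : ip x (c *: y + z) = c * ip x y + ip x z.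
Proof. exact: (inner_linear c x y z). Qed.

Lemma ipC H (x y : H) : ip y x = (ip x y)^*.
Proof. by rewrite /ip -[LHS](inner_star x y). Qed.

Lemma ip0 H (x : H) : ip x 0 = 0.
Proof.
have := ip_linear (-1) x 0 0; rewrite scaleN1r oppr0 addr0 mulN1r addNr.
by [].
Qed.

Lemma ipZ H c (x y : H) : ip x (c *: y) = c * ip x y.
Proof. by have := ip_linear c x y 0; rewrite addr0 ip0 addr0. Qed.

Lemma ipD H (x y z : H) : ip x (y + z) = ip x y + ip x z.
Proof. by have := ip_linear 1 x y z; rewrite scale1r mul1r. Qed.

Lemma ipN H (x y : H) : ip x (- y) = - ip x y.
Proof. by rewrite -scaleN1r ipZ mulN1r. Qed.

Lemma ipB H (x y z : H) : ip x (y - z) = ip x y - ip x z.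
Proof. by rewrite ipD ipN. Qed.

Lemma ip0l H (x : H) : ip 0 x = 0.
Proof. by rewrite ipC ip0 conjC0. Qed.

Lemma ipZl H c (x y : H) : ip (c *: x) y = c^* * ip x y.
Proof. by rewrite ipC ipZ rmorphM /= -ipC. Qed.

Lemma ipDl H (x y z : H) : ip (x + y) z = ip x z + ip y z.
Proof. by rewrite ipC ipD rmorphD /= -!ipC. Qed.

Lemma ipNl H (x y : H) : ip (- x) y = - ip x y.
Proof. by rewrite ipC ipN rmorphN /= -ipC. Qed.

Lemma ipBl H (x y z : H) : ip (x - y) z = ip x z - ip y z.
Proof. by rewrite ipDl ipNl. Qed.

Lemma ip_ge0 H (x : H) : 0 <= ip x x.
Proof.
have [b xb] := inner_pos x; rewrite /ip xb.
by have := mul_conjC_ge0 (b : R[i]); rewrite mulrC.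
Qed.

Lemma ipxx H (x : H) : ip x x = (nm x ^+ 2)%:C.
Proof. by rewrite rmorphXn /= -nmE inner_norm [RHS](ger0_norm (ip_ge0 x)). Qed.

Lemma ip_eq0 H (x : H) : ip x x = 0 -> x = 0.
Proof.
rewrite ipxx => /(congr1 (@complex.Re R)) /= /eqP; rewrite sqrf_eq0 => /eqP.
exact: nm_eq0.
Qed.

Lemma nmDsq H (x y : H) :
  (nm (x + y) ^+ 2)%:C = (nm x ^+ 2)%:C + (nm y ^+ 2)%:C + (ip x y + ip y x).
Proof. by rewrite -!ipxx !ipDl !ipD; ring. Qed.

Lemma parallelogram H (x y : H) :
  nm (x + y) ^+ 2 + nm (x - y) ^+ 2 = 2 * nm x ^+ 2 + 2 * nm y ^+ 2.
Proof.
apply: (@complexI R); rewrite [LHS]rmorphD /= !nmDsq ipN ipNl nmN; ring.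
Qed.

(** The quadratic [nm (n - c *: m) ^+ 2] in [c] is minimal at
    [c = ip m n / nm m ^+ 2]. *)
Lemma quad_min H (m n : H) : ip m m != 0 ->
  ip (n - (ip m n / ip m m) *: m) (n - (ip m n / ip m m) *: m)
  = ip n n - `|ip m n| ^+ 2 / ip m m.
Proof.
move=> m0; rewrite normCK.
have mR : (ip m m)^* = ip m m by rewrite -ipC.
rewrite ipBl !ipB !ipZ !ipZl rmorphM /= fmorphV /= mR -ipC.
by field.
Qed.

Lemma cauchy_schwarz H (x y : H) : nm (ip x y : cline R) <= nm x * nm y.
Proof.
have [x0|x0] := eqVneq (ip x x) 0.
  by rewrite (ip_eq0 x0) ip0l nm0 mulr_ge0// nm_ge0.
rewrite -(@ler_pXn2r _ 2)// ?nnegrE ?mulr_ge0 ?nm_ge0//.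
have := ip_ge0 (y - (ip x y / ip x x) *: x); rewrite quad_min// subr_ge0.
have xp : 0 < ip x x by rewrite lt_neqAle eq_sym x0 ip_ge0.
rewrite ler_pdivrMr// (nmE (ip x y : cline R)) !ipxx -rmorphXn -rmorphM lecR.
by rewrite exprMn mulrC.
Qed.

Lemma bounded_linear_ip H (x : H) (D : set H) :
  bounded_linear_on D (fun y => ip x y : cline R).
Proof.
apply/bounded_linear_nm; split; first by move=> c y z _ _; exact: (ip_linear c x y z).
by exists (nm x) => [|y _]; [exact: nm_ge0|exact: cauchy_schwarz].
Qed.

Lemma bounded_linear_cst0 (V L : completeNormedModType R[i]) (D : set V) :
  bounded_linear_on D (fun=> 0 : L).
Proof.
split=> [c x y _ _|]; first by rewrite scaler0 addr0.
by exists 0 => x _; rewrite normr0 mul0r.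
Qed.

Lemma orth_closure_lspan H (S : set H) (u : H) :
  (forall x, S x -> ip u x = 0) -> forall x, closure (lspan S) x -> ip u x = 0.
Proof.
move=> uS x Sx.
apply: (@bounded_linear_eq _ _ _ _ S (fun y => ip u y : cline R) (fun=> 0)) Sx => //.
- exact: sub_closure_lspan.
- exact: closure_lspan_subspace.
- exact: bounded_linear_ip.
- exact: bounded_linear_cst0.
Qed.

(** By the parallelogram law, a sequence in [M] that minimizes the distance to
    [h] is a Cauchy sequence. *)
Lemma nearest_point H (M : set H) (h : H) : linear_subspace M -> closed M ->
  exists2 p, M p & forall m, M m -> nm (h - p) <= nm (h - m).
Proof.
move=> sM Mc.
pose Q := [set nm (h - m) ^+ 2 | m in M].
have Qinf : has_inf Q.
  split; first by exists (nm (h - 0) ^+ 2), 0 => //; exact: (proj1 sM).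
  by exists 0 => _ [m _ <-]; exact: sqr_ge0.
have dle m : M m -> inf Q <= nm (h - m) ^+ 2.
  by move=> Mm; apply: ge_inf; [exact: (proj2 Qinf)|exists m].
have Hn n : exists m, M m /\ nm (h - m) ^+ 2 < inf Q + (n.+1%:R ^+ 2)^-1.
  have [|_ [m Mm <-] hm] := inf_adherent _ Qinf (eps := (n.+1%:R ^+ 2)^-1).
    by rewrite invr_gt0 exprn_gt0// ltr0n.
  by exists m.
have [u uP] := choice Hn.
have uC n m : (n <= m)%N -> nm (u m - u n) <= 2 / n.+1%:R.
  move=> nm'; have [Mn hn] := uP n; have [Mm hm] := uP m.
  (* the midpoint of [u n] and [u m] is at distance at least the infimum *)
  have Mid : M ((1 / 2) *: (u n + u m)).
    rewrite -[X in M X]addr0; apply: (proj2 sM) (proj1 sM).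
    by rewrite -[u n]scale1r; exact: (proj2 sM).
  have := parallelogram (h - u n) (h - u m).
  have -> : h - u n + (h - u m) = 2 *: (h - (1 / 2) *: (u n + u m)).
    rewrite scalerBr scalerA mulrA mulr1 divff// scale1r.
    by rewrite addrACA -opprD scaler_nat mulr2n.
  have -> : h - u n - (h - u m) = u m - u n by rewrite opprB addrC addrA subrK.
  rewrite nmZ exprMn (_ : complex.Re `|2| = 2); last first.
    by rewrite normr_nat -(rmorph_nat (real_complex R)).
  have := dle _ Mid.
  have mn : (m.+1%:R ^+ 2)^-1 <= (n.+1%:R ^+ 2)^-1 :> R.
    by rewrite lef_pV2 ?posrE ?exprn_gt0 ?ltr0n// ler_pXn2r// ?nnegrE ?ler0n// ler_nat.
  move=> h1 h2; rewrite -(@ler_pXn2r _ 2)// ?nnegrE ?nm_ge0 ?divr_ge0//.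
  rewrite expr_div_n; move: hn hm mn h1 h2.
  by move: (n.+1%:R ^- 2) (m.+1%:R ^- 2) (inf Q) => i j d; lra.
have [p pP] := cauchy_limit_inv uC.
exists p.
  have /closure_id -> := Mc; apply/closure_nmP => e /pP[N uN].
  by exists (u N); [exact: (uP N).1|exact: uN].
move=> m Mm; apply/ler_addgt0Pr => e e0.
have [N1 uN1] := pP (e / 2) (divr_gt0 e0 (ltr0n _ 2)).
pose N := maxn N1 (Num.truncn (2 / e)).
have /= hN := (uP N).2; have := uN1 N (leq_maxl _ _) => pN.
have iN : (N.+1%:R)^-1 <= e / 2 :> R.
  rewrite invf_ple ?posrE ?ltr0n ?divr_gt0// invf_div.
  apply: (le_trans (ltW (truncnS_gt _))); rewrite ler_nat ltnS; exact: leq_maxr.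
have hu : nm (h - u N) <= nm (h - m) + (N.+1%:R)^-1.
  rewrite -(@ler_pXn2r _ 2)// ?nnegrE ?addr_ge0 ?nm_ge0 ?invr_ge0//.
  have i0 : 0 <= (N.+1%:R)^-1 :> R by rewrite invr_ge0.
  have := dle _ Mm; have := nm_ge0 (h - m); move: hN i0; rewrite -exprVn.
  by move: (N.+1%:R^-1) (inf Q) => y d; nra.
have := nm_triangle (u N) h p; rewrite (nmB (u N)).
by move: hu iN; move: (N.+1%:R^-1) => y; lra.
Qed.

(** Comparing a nearest point [p] with [p + c *: m] for the optimal [c] of
    [quad_min] yields [ip m (h - p) = 0]. *)
Lemma projection H (M : set H) (h : H) : linear_subspace M -> closed M ->
  exists2 p, M p & forall m, M m -> ip m (h - p) = 0.
Proof.
move=> sM Mc; have [p Mp pmin] := nearest_point h sM Mc.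
exists p => // m Mm; set n := h - p.
have [m0|m0] := eqVneq (ip m m) 0; first by rewrite (ip_eq0 m0) ip0l.
have mp : 0 < ip m m by rewrite lt_neqAle eq_sym m0 ip_ge0.
have : ip n n <= ip (n - (ip m n / ip m m) *: m) (n - (ip m n / ip m m) *: m).
  rewrite !ipxx lecR ler_pXn2r// ?nnegrE ?nm_ge0// /n -addrA -opprD.
  by apply: pmin; rewrite addrC; exact: (proj2 sM).
rewrite quad_min// lerBrDr gerDl pmulr_lle0 ?invr_gt0// => n0.
apply/eqP; rewrite -normr_eq0 -sqrf_eq0 eq_le n0 exprn_ge0//.
Qed.

(** For [w] in [W], the projection of [w] onto the closed span of [S] stays in
    the closed subspace [W], so the difference is in [W] and orthogonal to
    [S]. *)
Lemma closure_lspan_orth H (S W : set H) : linear_subspace W -> closure W `<=` W ->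
  S `<=` W -> (forall u, W u -> (forall x, S x -> ip x u = 0) -> u = 0) ->
  W `<=` closure (lspan S).
Proof.
move=> sW Wc SW Sep w Ww.
have [p Sp pP] := projection w (@closure_lspan_subspace _ _ S) (@closed_closure _ (lspan S)).
have Wp : W p by apply/Wc; move: Sp; apply: closureS; exact: lspan_min.
suff /eqP : w - p = 0 by rewrite subr_eq0 => /eqP ->.
apply: Sep; first exact: linear_subspaceB.
by move=> x Sx; apply: pP; exact: sub_closure_lspan.
Qed.

(** In a Hilbert space, totality is the absence of nonzero orthogonal vectors;
    this is how totality is established and used below. *)
Lemma totalP H (S : set H) :
  Defs.total S <-> forall u, (forall x, S x -> ip x u = 0) -> u = 0.
Proof.
split=> [ST u uS|Sep].
  apply: ip_eq0; apply: (@orth_closure_lspan _ S); last by rewrite [closure _]ST.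
  by move=> x /uS xu; rewrite ipC xu conjC0.
apply/seteqP; split=> // x _.
by apply: (@closure_lspan_orth _ S setT) => // u _; exact: Sep.
Qed.

Lemma total_ip_inj H (S : set H) (x y : H) : Defs.total S ->
  (forall s, S s -> ip s x = ip s y) -> x = y.
Proof.
move=> /totalP ST xy; apply/eqP; rewrite -subr_eq0; apply/eqP/ST => s Ss.
by rewrite ipB xy// subrr.
Qed.

Lemma ip_inj H (x y : H) : (forall z, ip z x = ip z y) -> x = y.
Proof.
by move=> xy; apply/eqP; rewrite -subr_eq0; apply/eqP/ip_eq0; rewrite ipB xy subrr.
Qed.

(** The kernel of a nonzero functional has a vector [n] orthogonal to it, and
    [f n *: x - f x *: n] is in the kernel for all [x]. *)
Lemma riesz H (f : H -> cline R) : bounded_linear_on setT f ->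
  exists v, forall x, f x = ip v x.
Proof.
move=> fb; have fl := fb.1.
have sT := @linear_subspace_setT R H.
pose M := [set x | f x = 0].
have sM : linear_subspace M.
  split; first exact: linear_on0 sT fl.
  by move=> c x y fx fy; rewrite /M /= fl// fx fy scaler0 addr0.
have Mc : closed M.
  apply/closure_id/seteqP; split; first exact: subset_closure.
  move=> x Mx; apply: (@bounded_linear_eq _ _ _ (closure (lspan M)) M f (fun=> 0)) => //.
  - exact: sub_closure_lspan.
  - exact: closure_lspan_subspace.
  - exact: bounded_linear_sub fb.
  - exact: bounded_linear_cst0.
  - by move: Mx; apply: closureS; exact: sub_lspan.
have [f0|/existsNP[h fh]] := pselect (forall x, f x = 0).
  by exists 0 => x; rewrite f0 ip0l.
have [p Mp pP] := projection h sM Mc.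
pose n := h - p.
have fn : f n = f h by rewrite /n (linear_onB fl)// Mp subr0.
have n0 : ip n n != 0.
  apply/eqP => /ip_eq0 n0; apply: fh; rewrite -fn n0.
  exact: linear_on0 sT fl.
exists (((f n : R[i])^* / ip n n) *: n) => x.
have Mx : M ((f n : R[i]) *: x - (f x : R[i]) *: n).
  rewrite /M /= (linear_onB fl)// !(linear_onZ _ sT fl)//.
  by apply/eqP; rewrite subr_eq0; apply/eqP; exact: mulrC.
have := congr1 Num.conj (pP _ Mx).
rewrite -/n -ipC ipB !ipZ conjC0 => /eqP; rewrite subr_eq0 => /eqP e.
rewrite ipZl rmorphM /= conjCK fmorphV /= -(ipC n n) mulrAC e -mulrA divff//.
by rewrite mulr1.
Qed.

(** [adjoint] is a choice with a default value; the Riesz theorem makes the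
    choice meaningful for bounded operators. *)
Lemma adjoint_exists H K (S : H -> K) : bounded_linear_on setT S ->
  forall x y, ip (S x) y = ip x (adjoint S y).
Proof.
move=> Sb.
suff [S' S'P] : exists S' : K -> H, forall x y, inner (S x) y = inner x (S' y).
  move=> x y; rewrite /adjoint.
  by case: xgetP => [S'' _ /= S''P|/(_ S')]; [exact: S''P|case; exact: S'P].
suff : forall y, exists v, forall x, inner (S x) y = inner x v.
  by move=> /choice[S' S'P]; exists S' => x y; exact: S'P.
move=> y.
have [|v vP] := @riesz H (fun x => ip y (S x)).
  exact: (@bounded_linear_comp _ _ _ _ setT setT S _ _ Sb (@bounded_linear_ip K y setT)).
exists v => x; rewrite -[LHS]/(ip _ _) -[RHS]/(ip _ _) ipC.
by have := vP x; rewrite /= => ->; rewrite -ipC.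
Qed.

End HilbertSpaces.

(** * Isometries prescribed on a generating family *)

Section IsometricExtension.
Variable R : realType.
Implicit Types H K : hilbertSpace R.

Section Combinations.
Variable I : Type.

Definition comb K (g : I -> K) (s : seq (R[i] * I)) : K :=
  \sum_(p <- s) p.1 *: g p.2.

Lemma comb_linear K (g : I -> K) c s t :
  c *: comb g s + comb g t = comb g ([seq (c * p.1, p.2) | p <- s] ++ t).
Proof.
rewrite /comb big_cat big_map scaler_sumr; congr (_ + _); apply: eq_bigr => p _ /=.
by rewrite scalerA.
Qed.

Lemma lspan_comb K (g : I -> K) x : lspan (range g) x <-> exists s, x = comb g s.
Proof.
split.
  apply: (@lspan_min _ _ _ [set y | exists s, y = comb g s]); last first.
    by move=> _ [i _ <-]; exists [:: (1, i)]; rewrite /comb big_seq1 scale1r.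
  split; first by exists [::]; rewrite /comb big_nil.
  by move=> c _ _ [s ->] [t ->]; rewrite comb_linear; eexists.
move=> [s ->]; rewrite /comb; have [s0 s1] := linear_subspace_lspan (range g).
elim/big_ind: _ => [//|x1 x2 h1 h2|p _]; first by rewrite -[x1]scale1r; exact: s1.
by rewrite -[_ *: _]addr0; apply: s1 => //; apply: sub_lspan; exists p.2.
Qed.

Lemma comb_sub K (g : I -> K) s t :
  comb g s - comb g t = comb g ([seq (-1 * p.1, p.2) | p <- t] ++ s).
Proof. by rewrite -comb_linear scaleN1r addrC. Qed.

Lemma ip_comb H K (g : I -> H) (f : I -> K) :
  (forall i j, ip (f i) (f j) = ip (g i) (g j)) ->
  forall s t, ip (comb f s) (comb f t) = ip (comb g s) (comb g t).
Proof.
move=> gf; suff ip_r i s : ip (f i) (comb f s) = ip (g i) (comb g s).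
  move=> s t; elim: s => [|p s IHs]; first by rewrite /comb !big_nil !ip0l.
  by rewrite /comb !big_cons !ipDl !ipZl ip_r; congr (_ + _); exact: IHs.
elim: s => [|p s IHs]; first by rewrite /comb !big_nil !ip0.
by rewrite /comb !big_cons !ipD !ipZ gf; congr (_ + _); exact: IHs.
Qed.

End Combinations.

(** The closed linear relation spanned by the pairs [(g i, f i)].  When the
    family [f] has the same inner products as [g], this relation is the graph
    of the isometry that maps [g i] to [f i]. *)
Definition span_graph H K (I : Type) (g : I -> H) (f : I -> K) x y : Prop :=
  forall e : R, 0 < e -> exists s, nm (x - comb g s) < e /\ nm (y - comb f s) < e.

Lemma span_graph_sym H K I (g : I -> H) (f : I -> K) x y :
  span_graph g f x y -> span_graph f g y x.
Proof. by move=> xy e /xy[s []]; exists s. Qed.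

Lemma span_graph_dom H K I (g : I -> H) (f : I -> K) x y :
  span_graph g f x y -> closure (lspan (range g)) x.
Proof.
move=> xy; apply/closure_nmP => e /xy[s [xs _]]; exists (comb g s) => //.
by apply/lspan_comb; exists s.
Qed.

Section SameInnerProducts.
Variables (H K : hilbertSpace R) (I : Type) (g : I -> H) (f : I -> K).
Hypothesis gf : forall i j, ip (f i) (f j) = ip (g i) (g j).

Lemma nm_comb s : nm (comb f s) = nm (comb g s).
Proof.
have := ip_comb gf s s; rewrite !ipxx => /complexI /eqP.
by rewrite eqrXn2 ?nm_ge0// => /eqP.
Qed.

Lemma nm_comb_sub s t : nm (comb f s - comb f t) = nm (comb g s - comb g t).
Proof. by rewrite !comb_sub nm_comb. Qed.

Lemma span_graph_linear c x y x' y' : span_graph g f x y -> span_graph g f x' y' ->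
  span_graph g f (c *: x + x') (c *: y + y').
Proof.
move=> xy xy' e e0.
pose k := complex.Re `|c| + 1.
have c0 : 0 <= complex.Re `|c| by exact: (nm_ge0 (c : cline R)).
have k0 : 0 < k by rewrite ltr_wpDl.
have [|s [xs ys]] := xy (e / 2 / k); first by rewrite !divr_gt0.
have [|t [xt yt]] := xy' (e / 2); first by rewrite divr_gt0.
exists ([seq (c * p.1, p.2) | p <- s] ++ t); rewrite -!comb_linear.
have le (V : hilbertSpace R) (u v u' v' : V) : nm (u - u') < e / 2 / k ->
    nm (v - v') < e / 2 -> nm (c *: u + v - (c *: u' + v')) < e.
  move=> uu' vv'; rewrite opprD addrACA -scalerBr; apply: le_lt_trans (nmD _ _) _.
  rewrite nmZ [ltRHS]splitr ler_ltD//.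
  move: uu'; rewrite ltr_pdivlMr// mulrC => /ltW; apply: le_trans.
  by rewrite ler_wpM2r ?nm_ge0// lerDl.
by split; exact: le.
Qed.

Lemma span_graph_nm x y : span_graph g f x y -> nm y = nm x.
Proof.
move=> xy; apply/eqP; rewrite eq_le; apply/andP; split; apply/ler_addgt0Pr => e e0;
  have [s [xs ys]] := xy _ (divr_gt0 e0 (ltr0n _ 2)).
  have := nm_triangle (comb f s) y 0; have := nm_triangle x (comb g s) 0.
  by rewrite !subr0 nm_comb (nmB _ x); lra.
have := nm_triangle (comb g s) x 0; have := nm_triangle y (comb f s) 0.
by rewrite !subr0 nm_comb (nmB _ y); lra.
Qed.

(** The coefficients of combinations of [g] that approximate [x] give
    combinations of [f] that form a Cauchy sequence, because combinations of [f]
    and of [g] with the same coefficients have the same norm. *)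
Lemma span_graph_total x : closure (lspan (range g)) x -> exists y, span_graph g f x y.
Proof.
move=> /closure_nmP gx.
have [u uP] : exists u : nat -> seq (R[i] * I), forall n, nm (x - comb g (u n)) < n.+1%:R^-1.
  have near n : exists s, nm (x - comb g s) < n.+1%:R^-1.
    have [|y /lspan_comb[s ->] xs] := gx (n.+1%:R^-1); first by rewrite invr_gt0.
    by exists s.
  by exists (fun n => sval (cid (near n))) => n; exact: (svalP (cid (near n))).
have inv n m : (n <= m)%N -> m.+1%:R^-1 <= n.+1%:R^-1 :> R.
  by move=> nm'; rewrite lef_pV2 ?posrE ?ltr0n// ler_nat.
have [|y yP] := @cauchy_limit_inv _ _ (fun n => comb f (u n)) 2.
  move=> n m /inv nm'; rewrite nm_comb_sub.
  have := nm_triangle x (comb g (u m)) (comb g (u n)); rewrite (nmB _ x).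
  have := uP n; have := uP m.
  by move: nm'; move: (n.+1%:R^-1) (m.+1%:R^-1) => a b; lra.
exists y => e e0; have [N yN] := yP e e0.
pose M := maxn N (Num.truncn e^-1).
exists (u M); split; last by apply: yN; exact: leq_maxl.
apply: lt_le_trans (uP M) _; rewrite invf_ple ?posrE ?ltr0n//.
by apply: (le_trans (ltW (truncnS_gt _))); rewrite ler_nat ltnS leq_maxr.
Qed.

Lemma span_graph_gen i : span_graph g f (g i) (f i).
Proof.
move=> e e0; exists [:: (1, i)]; rewrite /comb !big_seq1 !scale1r !subrr.
by rewrite !nm0.
Qed.

Lemma span_graph_fun x y y' : span_graph g f x y -> span_graph g f x y' -> y = y'.
Proof.
move=> xy xy'; have := span_graph_nm (span_graph_linear (-1) xy xy').
rewrite !scaleN1r addNr nm0 => /nm_eq0 /eqP.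
by rewrite addrC subr_eq0 => /eqP.
Qed.

End SameInnerProducts.

(** Outside the closed span of [g], [S] is arbitrary, as for [the_operator]. *)
Definition extension H K (I : Type) (g : I -> H) (f : I -> K) (S : H -> K) : Prop :=
  [/\ bounded_linear_on (closure (lspan (range g))) S,
      forall x y, closure (lspan (range g)) x -> closure (lspan (range g)) y ->
        ip (S x) (S y) = ip x y,
      forall i, S (g i) = f i &
      S @` closure (lspan (range g)) = closure (lspan (range f))].

Lemma bounded_linear_isometry H K (D : set H) (S : H -> K) :
  linear_on D S -> (forall x, D x -> nm (S x) = nm x) -> bounded_linear_on D S.
Proof.
move=> Sl Sn; apply/bounded_linear_nm; split=> //.
by exists 1 => // x Dx; rewrite mul1r Sn.
Qed.

Lemma extension_exists H K (I : Type) (g : I -> H) (f : I -> K) :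
  (forall i j, ip (f i) (f j) = ip (g i) (g j)) -> exists S, extension g f S.
Proof.
move=> gf; pose D := closure (lspan (range g)).
have sD : linear_subspace D by exact: closure_lspan_subspace.
pose S x := xget 0 (span_graph g f x).
have SP x : D x -> span_graph g f x (S x).
  by move=> /(span_graph_total gf)[y xy]; rewrite /S; apply: xgetPex; exists y.
have gD i : D (g i) by apply: sub_closure_lspan; exists i.
have Sg i : S (g i) = f i.
  by apply: span_graph_fun (SP _ (gD i)) (span_graph_gen _ _ _).
have Sl : linear_on D S.
  move=> c x y Dx Dy; apply: span_graph_fun (span_graph_linear _ (SP _ Dx) (SP _ Dy)) => //.
  by apply: SP; exact: (proj2 sD).
have Sb : bounded_linear_on D S.
  by apply: bounded_linear_isometry => // x Dx; exact: span_graph_nm (SP _ Dx).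
exists S; split => //.
- move=> x y Dx Dy.
  (* density in the second variable, then in the first one *)
  have ip_bounded u : bounded_linear_on D (fun z => ip u (S z) : cline R).
    apply: (@bounded_linear_comp _ _ _ _ D setT S _ _ Sb) => //.
    exact: bounded_linear_ip.
  have step (z : H) : (forall i, ip (S z) (f i) = ip z (g i)) ->
      forall w, D w -> ip (S z) (S w) = ip z w.
    move=> zi; apply: (@bounded_linear_eq _ _ _ D (range g)
      (fun w => ip (S z) (S w) : cline R) (fun w => ip z w : cline R)) => //.
    - by move=> _ [i _ <-]; exact: gD.
    - exact: bounded_linear_ip.
    - by move=> _ [i _ <-]; rewrite Sg; exact: zi.
  apply: (step) => // i; rewrite ipC [RHS]ipC -Sg; congr (_^*).
  by apply: step => // j; rewrite Sg; exact: gf.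
- apply/seteqP; split=> [_ [x Dx <-]|y Dy].
    exact: span_graph_dom (span_graph_sym (SP _ Dx)).
  have [x yx] := span_graph_total (fun i j => esym (gf i j)) Dy.
  have xy := span_graph_sym yx; have Dx := span_graph_dom xy.
  by exists x => //; apply: span_graph_fun (SP _ Dx) xy.
Qed.

(** By uniqueness, the operator chosen by [the_operator] from its values on
    generators is the isometry of [extension_exists]. The properties [P] that
    occur quantify over the generators in various ways, hence the equivalence in
    the hypothesis. *)
Lemma the_operator_extension H K (I : Type) (g : I -> H) (f : I -> K)
    (D : set H) (P : (H -> K) -> Prop) :
  D = closure (lspan (range g)) -> (forall S, P S <-> forall i, S (g i) = f i) ->
  (forall i j, ip (f i) (f j) = ip (g i) (g j)) ->
  extension g f (the_operator D P).
Proof.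
move=> -> Pgf gf; have [S0 [Sb0 Si0 Sg0 SD0]] := extension_exists gf.
rewrite /the_operator; case: xgetP => [S _ /= [Sb /Pgf Sg]|/(_ S0)]; last first.
  by case; split=> //; exact/Pgf.
have SS0 x : closure (lspan (range g)) x -> S x = S0 x.
  apply: (@bounded_linear_eq _ _ _ _ (range g)) => //.
  - exact: sub_closure_lspan.
  - exact: closure_lspan_subspace.
  - by move=> _ [i _ <-]; rewrite Sg Sg0.
split=> //; first by move=> x y Dx Dy; rewrite !SS0// Si0.
by rewrite -SD0; apply/seteqP; split=> _ [x Dx <-]; exists x => //; rewrite SS0.
Qed.

Definition isometric_map H K (S : H -> K) : Prop :=
  bounded_linear_on setT S /\ forall x y, ip (S x) (S y) = ip x y.

Lemma isometry_comp H K (L : hilbertSpace R) (S : H -> K) (S' : K -> L) :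
  isometric_map S -> isometric_map S' -> isometric_map (S' \o S).
Proof.
move=> [Sb Si] [Sb' Si']; split; last by move=> x y /=; rewrite Si' Si.
exact: (@bounded_linear_comp _ _ _ _ setT setT).
Qed.

Lemma adjointK H K (S : H -> K) : isometric_map S -> cancel S (adjoint S).
Proof.
move=> [Sb Si] x; apply: ip_inj => z.
by rewrite -(adjoint_exists Sb) Si.
Qed.

Lemma extension_isometry H K I (g : I -> H) (f : I -> K) S :
  Defs.total (range g) -> extension g f S -> isometric_map S.
Proof. by rewrite /extension => -> [Sb Si _ _]; split=> // x y; exact: Si. Qed.

End IsometricExtension.

(** * Representations of C*-algebras are bounded *)

Section BoundedAction.
Variables (R : realType) (A : cstarAlgebra R).
Implicit Types (a b c : A).

Lemma nm_cmul a b : nm (cmul a b) <= nm a * nm b.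
Proof. by rewrite -lecR rmorphM /= -!nmE cnormM. Qed.

Lemma nm_cstarM a : nm (cmul (cstar a) a) = nm a ^+ 2.
Proof. by apply: (@complexI R); rewrite rmorphXn /= -!nmE cnorm_star. Qed.

Lemma nm_cstar_le a : nm a <= nm (cstar a).
Proof.
have := nm_cmul (cstar a) a; rewrite nm_cstarM expr2.
have [->|a0] := eqVneq (nm a) 0; first by rewrite nm_ge0.
by rewrite ler_pM2r// lt_neqAle eq_sym a0 nm_ge0.
Qed.

Lemma nm_cstar a : nm (cstar a) = nm a.
Proof.
apply/eqP; rewrite eq_le nm_cstar_le andbT.
by have := nm_cstar_le (cstar a); rewrite cstarK.
Qed.

Lemma cmulBr a b c : cmul a (b - c) = cmul a b - cmul a c.
Proof. by rewrite addrC -scaleN1r cmul_linearr scaleN1r addrC. Qed.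

Lemma cmulBl a b c : cmul (a - b) c = cmul a c - cmul b c.
Proof. by rewrite addrC -scaleN1r cmul_linearl scaleN1r addrC. Qed.

Lemma cstarD a b : cstar (a + b) = cstar a + cstar b.
Proof. by have := cstar_semilinear 1 a b; rewrite conjC1 !scale1r. Qed.

Lemma cstar0 : cstar (0 : A) = 0.
Proof. by apply: nm_eq0; rewrite nm_cstar nm0. Qed.

Lemma cstarZ k a : cstar (k *: a) = k^* *: cstar a.
Proof. by have := cstar_semilinear k a 0; rewrite !addr0 cstar0 addr0. Qed.

(** If [a] is self-adjoint with norm at most 1/2, then [b |-> (a + b b) / 2]
    is a contraction of the ball of radius 1/2.  In a unitization, its fixed
    point is [1 - sqrt (1 - a)]. *)
Lemma selfadjoint_root a : cstar a = a -> nm a <= 1 / 2 ->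
  exists2 b, cstar b = b & 2 *: b = a + cmul b b.
Proof.
move=> sa an; pose f b := (1 / 2 : R[i]) *: (a + cmul b b).
have nm_half b : nm ((1 / 2 : R[i]) *: b) = 1 / 2 * nm b.
  rewrite nmZ; congr (_ * _).
  have -> : (1 / 2 : R[i]) = (1 / 2 : R)%:C by rewrite fmorph_div rmorph1 rmorph_nat.
  by rewrite ger0_norm// ler0c divr_ge0.
have f_ball b : nm b <= 1 / 2 -> nm (f b) <= 1 / 2.
  move=> bn; rewrite nm_half; have := nmD a (cmul b b); have := nm_cmul b b.
  have := nm_ge0 b; nra.
have f_contr b c : nm b <= 1 / 2 -> nm c <= 1 / 2 -> nm (f b - f c) <= 1 / 2 * nm (b - c).
  move=> bn cn; rewrite -scalerBr nm_half opprD addrACA subrr add0r.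
  have -> : cmul b b - cmul c c = cmul b (b - c) + cmul (b - c) c.
    by rewrite cmulBr cmulBl addrA subrK.
  have := nmD (cmul b (b - c)) (cmul (b - c) c).
  have := nm_cmul b (b - c); have := nm_cmul (b - c) c; have := nm_ge0 (b - c).
  nra.
pose u n := iter n f 0.
have u_ball n : nm (u n) <= 1 / 2.
  by elim: n => [|n IHn] /=; [rewrite nm0; lra|exact: f_ball].
have u_geo n k : nm (u (k + n)%N - u n) <= (2 ^ n)%:R^-1.
  elim: n => [|n IHn].
    rewrite subr0 expn0 invr1; have := u_ball (k + 0)%N; lra.
  rewrite addnS /= expnS natrM invfM; apply: le_trans (f_contr _ _ (u_ball _) (u_ball _)) _.
  by rewrite mul1r ler_wpM2l.
have [|b bP] := @cauchy_limit_inv _ _ u 1.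
  move=> n m nm'; rewrite -(subnK nm') mul1r; apply: le_trans (u_geo _ _) _.
  by rewrite lef_pV2 ?posrE ?ltr0n ?expn_gt0// ler_nat ltn_expl.
have b_ball : nm b <= 1 / 2.
  apply/ler_addgt0Pr => e /bP[N /(_ N (leqnn N))].
  by have := nmD (b - u N) (u N); rewrite subrK; have := u_ball N; lra.
have fb : f b = b.
  apply/eqP; rewrite -subr_eq0; apply/eqP/nm_small => e e0.
  have [N uN] := bP (e / 2) (divr_gt0 e0 (ltr0n _ 2)).
  have := uN N (leqnn _); have := uN N.+1 (leqnSn _).
  have := nm_triangle (u N.+1) (f b) b; rewrite (nmB (u N.+1) b).
  have := f_contr _ _ b_ball (u_ball N); rewrite -/(u N.+1).
  have := nm_ge0 (b - u N); lra.
have f_star c : cstar (f c) = f (cstar c).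
  by rewrite /f cstarZ cstarD cstarM sa rmorphM /= fmorphV /= rmorph1 rmorph_nat.
exists b.
  apply/eqP; rewrite -subr_eq0; apply/eqP/nm_eq0.
  have sb_ball : nm (cstar b) <= 1 / 2 by rewrite nm_cstar.
  have := f_contr _ _ sb_ball b_ball; rewrite -f_star fb.
  have := nm_ge0 (cstar b - b); lra.
by rewrite -{1}fb /f scalerA mulrA mulr1 divff ?scale1r// pnatr_eq0.
Qed.

Variable H : representation A.
Implicit Types h k : H.

Lemma ip_lact a h k : ip h (lact a k) = ip (lact (cstar a) h) k.
Proof. by rewrite /ip [RHS]lact_adj cstarK. Qed.

Lemma ip_lactl a h k : ip (lact a h) k = ip h (lact (cstar a) k).
Proof. exact: (lact_adj a h k). Qed.

Lemma lact_linear_r a (z : R[i]) h k : lact a (z *: h + k) = z *: lact a h + lact a k.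
Proof. by apply: ip_inj => w; rewrite ip_linear !ip_lact ip_linear. Qed.

Lemma lact0 h : lact (0 : A) h = 0.
Proof.
have := lact_linear (-1) (0 : A) 0 h.
by rewrite scaler0 addr0 scaleN1r addNr.
Qed.

Lemma lactZ (z : R[i]) a h : lact (z *: a) h = z *: lact a h.
Proof. by have := lact_linear z a 0 h; rewrite addr0 lact0 addr0. Qed.

(** With [2 b = a + b b] and [b] self-adjoint, [ip h h - ip h (lact a h)] is the
    square of the norm of [h - lact b h]. *)
Lemma lact_selfadjoint_le a h : cstar a = a -> nm a <= 1 / 2 ->
  ip h (lact a h) <= ip h h.
Proof.
move=> sa /(selfadjoint_root sa)[b sb ab].
have := ip_ge0 (h - lact b h).
have -> : ip (h - lact b h) (h - lact b h) = ip h h - ip h (lact a h).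
  have -> : ip h (lact a h) = 2 * ip h (lact b h) - ip h (lact b (lact b h)).
    have {1}-> : a = 2 *: b + -1 *: cmul b b by rewrite ab scaleN1r addrK.
    by rewrite lact_linear lactZ lactM ip_linear ipZ mulN1r.
  by rewrite ipBl !ipB !ip_lactl sb; ring.
by rewrite subr_ge0.
Qed.

(** For [c = a^* a / (2 |a| ^+ 2)], the inequality [lact_selfadjoint_le] bounds
    [nm (lact a h) ^+ 2 = ip h (lact (a^* a) h)]. The sharp constant would be 1;
    only continuity matters here. *)
Lemma nm_lact a h : nm (lact a h) <= 2 * nm a * nm h.
Proof.
have [a0|a0] := eqVneq (nm a) 0.
  by rewrite (nm_eq0 a0) lact0 !nm0 mulr0 mul0r.
have ap : 0 < nm a by rewrite lt_neqAle eq_sym a0 nm_ge0.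
pose r : R := 2 * nm a ^+ 2.
have r0 : 0 < r by rewrite mulr_gt0// exprn_gt0.
pose c := (r^-1)%:C *: cmul (cstar a) a.
have sc : cstar c = c.
  by rewrite /c cstarZ cstarM cstarK (conj_Creal (x := (r^-1)%:C)) // complex_real.
have nc : nm c <= 1 / 2.
  rewrite /c nmZ nm_cstarM ger0_norm ?ler0c ?invr_ge0 ?(ltW r0)//=.
  by rewrite ler_pdivrMl// /r; lra.
have := lact_selfadjoint_le h sc nc.
rewrite /c lactZ ipZ lactM -{1}(cstarK a) -ip_lactl cstarK.
rewrite !ipxx -rmorphM lecR ler_pdivrMl// => le2.
rewrite -(@ler_pXn2r _ 2)// ?nnegrE ?mulr_ge0 ?nm_ge0//.
apply: le_trans le2 _; have := mulr_ge0 (sqr_ge0 (nm a)) (sqr_ge0 (nm h)).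
by rewrite /r; lra.
Qed.

Lemma bounded_linear_lact a : bounded_linear_on setT (lact a : H -> H).
Proof.
apply/bounded_linear_nm; split; first by move=> c h k _ _; exact: lact_linear_r.
by exists (2 * nm a) => [|h _]; [rewrite mulr_ge0// nm_ge0|exact: nm_lact].
Qed.

End BoundedAction.

(** * Interior tensor products with a Hilbert space *)

Section TensorHilbert.
Variables (R : realType) (T : tensor_products R) (A : cstarAlgebra R).
Local Notation "F \OX G" := (tensor T F G) (at level 40, left associativity).
Local Notation "x \ox g" := (etensor T x g) (at level 40, left associativity).
Implicit Types (F G : correspondence A A) (H K : representation A).

Lemma ip_tens F H (x y : F) (h k : H) : ip (x \ox h) (y \ox k) = ip h (lact (inner x y) k).
Proof. exact: (tens_inner (T F H)). Qed.

Lemma lact_tens (B : cstarAlgebra R) F (G : correspondence A B) a (x : F) (g : G) :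
  lact a (x \ox g) = lact a x \ox g.
Proof. exact: tens_lact. Qed.

Lemma total_tens (B : cstarAlgebra R) F (G : correspondence A B) :
  Defs.total [set x \ox g | x in [set: F] & g in [set: G]].
Proof. exact: tens_total. Qed.

(** Bilinearity is forced by the inner products of elementary tensors. *)
Lemma tens_linearl F H c (x y : F) (h : H) :
  (c *: x + y) \ox h = c *: (x \ox h) + y \ox h.
Proof.
apply: (total_ip_inj (@total_tens _ F H)) => _ [w _ [k _ <-]].
by rewrite ip_linear !ip_tens inner_linear lact_linear ip_linear.
Qed.

Lemma tens_linearr F H c (x : F) (h k : H) :
  x \ox (c *: h + k) = c *: (x \ox h) + x \ox k.
Proof.
apply: (total_ip_inj (@total_tens _ F H)) => _ [w _ [z _ <-]].
by rewrite ip_linear !ip_tens lact_linear_r ip_linear.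
Qed.

Lemma nm_inner F (x : F) : nm (inner x x) = nm x ^+ 2.
Proof. by apply: (@complexI R); rewrite rmorphXn /= -!nmE -inner_norm. Qed.

Lemma nm_tens F H (x : F) (h : H) : nm (x \ox h) <= 2 * nm x * nm h.
Proof.
rewrite -(@ler_pXn2r _ 2)// ?nnegrE ?mulr_ge0 ?nm_ge0// -lecR -ipxx ip_tens.
have le1 := cauchy_schwarz h (lact (inner x x) h).
have le2 : nm h * nm (lact (inner x x) h) <= nm h * (2 * nm (inner x x) * nm h).
  by rewrite ler_wpM2l ?nm_ge0// nm_lact.
have ge0 : 0 <= ip h (lact (inner x x) h) by rewrite -ip_tens ip_ge0.
rewrite -(ger0_norm ge0) (nmE (ip h _ : cline R)) lecR.
apply: le_trans le1 (le_trans le2 _); rewrite nm_inner.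
have := mulr_ge0 (sqr_ge0 (nm x)) (sqr_ge0 (nm h)); lra.
Qed.

Lemma bounded_linear_tensl F H (h : H) :
  bounded_linear_on setT (fun x : F => x \ox h).
Proof.
apply/bounded_linear_nm; split; first by move=> c x y _ _; exact: tens_linearl.
exists (2 * nm h) => [|x _]; first by rewrite mulr_ge0// nm_ge0.
by rewrite mulrAC; exact: nm_tens.
Qed.

Lemma bounded_linear_tensr F H (x : F) :
  bounded_linear_on setT (fun h : H => x \ox h).
Proof.
apply/bounded_linear_nm; split; first by move=> c h k _ _; exact: tens_linearr.
by exists (2 * nm x) => [|h _]; [rewrite mulr_ge0// nm_ge0|exact: nm_tens].
Qed.

Lemma total_tensl F H (S : set F) : Defs.total S ->
  Defs.total [set x \ox h | x in S & h in [set: H]].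
Proof.
move=> ST; apply/totalP => u uS; apply: (proj1 (totalP _) (@total_tens _ F H)).
move=> _ [x _ [h _ <-]]; rewrite ipC.
suff -> : ip u (x \ox h) = 0 by rewrite conjC0.
apply: (@total_bounded_linear_eq _ F (cline R) S (fun y => ip u (y \ox h)) (fun=> 0)) => //.
- apply: (@bounded_linear_comp _ _ _ _ setT setT (fun y => y \ox h)) => //.
    exact: bounded_linear_tensl.
  exact: bounded_linear_ip.
- exact: bounded_linear_cst0.
- by move=> y Sy; rewrite ipC uS ?conjC0//; exists y => //; exists h.
Qed.

Lemma total_tensr F H (S : set H) : Defs.total S ->
  Defs.total [set x \ox h | x in [set: F] & h in S].
Proof.
move=> ST; apply/totalP => u uS; apply: (proj1 (totalP _) (@total_tens _ F H)).
move=> _ [x _ [h _ <-]]; rewrite ipC.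
suff -> : ip u (x \ox h) = 0 by rewrite conjC0.
apply: (@total_bounded_linear_eq _ H (cline R) S (fun k => ip u (x \ox k)) (fun=> 0)) => //.
- apply: (@bounded_linear_comp _ _ _ _ setT setT (fun y => x \ox y)) => //.
    exact: bounded_linear_tensr.
  exact: bounded_linear_ip.
- exact: bounded_linear_cst0.
- by move=> k Sk; rewrite ipC uS ?conjC0//; exists x => //; exists k.
Qed.

Lemma total_tens3 F G H :
  Defs.total (range (fun p : F * G * H => p.1.1 \ox p.1.2 \ox p.2)).
Proof.
rewrite [range _](_ : _ = [set z \ox h | z in [set x \ox y | x in [set: F] & y in [set: G]]
    & h in [set: H]]); first exact/total_tensl/total_tens.
apply/seteqP; split=> [_ [[[x y] h] _ <-]|_ [_ [x _ [y _ <-]] [h _ <-]]].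
  by exists (x \ox y); [exists x => //; exists y|exists h].
by exists (x, y, h).
Qed.

Lemma total_lact_commute H K (g : set H) (S : H -> K) :
  Defs.total g -> bounded_linear_on setT S ->
  (forall a x, g x -> S (lact a x) = lact a (S x)) ->
  forall a x, S (lact a x) = lact a (S x).
Proof.
move=> gT Sb Sg a; apply: (total_bounded_linear_eq gT) => [||x].
- by apply: (@bounded_linear_comp _ _ _ _ setT setT) Sb => //; exact: bounded_linear_lact.
- by apply: (@bounded_linear_comp _ _ _ _ setT setT) Sb _ => //; exact: bounded_linear_lact.
- exact: Sg.
Qed.

Lemma tensorAP F G H : let S := @tensorA R T A F G H in
  [/\ isometric_map S, forall x y h, S (x \ox y \ox h) = x \ox (y \ox h) &
      forall a z, S (lact a z) = lact a (S z)].
Proof.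
move=> S; have tot := @total_tens3 F G H.
have Sext : extension (fun p : F * G * H => p.1.1 \ox p.1.2 \ox p.2)
    (fun p => p.1.1 \ox (p.1.2 \ox p.2)) S.
  apply: the_operator_extension; first by rewrite [RHS]tot.
    move=> S'; split=> [S'P [[x y] h]|S'P x y h]; first exact: S'P.
    exact: (S'P (x, y, h)).
  move=> [[x y] h] [[x' y'] h'] /=; rewrite !ip_tens lact_tens ip_tens.
  by rewrite [inner (x \ox y) _](tens_inner (T F G)).
have Si := extension_isometry tot Sext; have [_ _ Sg _] := Sext.
have Sxyh x y h : S (x \ox y \ox h) = x \ox (y \ox h) by exact: (Sg (x, y, h)).
split=> //; apply: total_lact_commute tot (proj1 Si) _.
move=> a _ [[[x y] h] _ <-] /=.
by rewrite !lact_tens !Sxyh lact_tens.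
Qed.

End TensorHilbert.

(** * Isometric covariant representations *)

Section IsometricRepresentations.
Variables (R : realType) (T : tensor_products R) (A : cstarAlgebra R).
Local Notation "F \OX G" := (tensor T F G) (at level 40, left associativity).
Local Notation "x \ox g" := (etensor T x g) (at level 40, left associativity).
Implicit Types (F G : correspondence A A) (H K : representation A).

(** The algebraic content of an isometric covariant representation, from which
    the boundedness of [V] also follows. Unlike [covariant] and [isometric], it
    is easily seen to pass to the product of two representations. *)
Definition isorep F H (V : F -> H -> H) : Prop :=
  [/\ forall x (c : R[i]) h k, V x (c *: h + k) = c *: V x h + V x k,
      forall (c : R[i]) x y h, V (c *: x + y) h = c *: V x h + V y h,
      forall x y h k, ip (V x h) (V y k) = ip h (lact (inner x y) k) &
      forall a x h, V (lact a x) h = lact a (V x h)].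

Lemma inner_ractl F (x y : F) a : inner (ract x a) y = cmul (cstar a) (inner x y).
Proof. by rewrite -inner_star inner_ract cstarM inner_star. Qed.

(** Left covariance alone follows from the two-sided covariance because [sigma]
    is nondegenerate and [V (x a) = V x sigma a], the latter by comparison of
    inner products. *)
Lemma covariant_isorep F H (V : F -> H -> H) : covariant V -> isometric V -> isorep V.
Proof.
move=> [Vb Vl Vc _] Vi.
have Vip x y h k : ip (V x h) (V y k) = ip h (lact (inner x y) k).
  by rewrite (adjoint_exists (Vb x)) Vi.
split=> //; first by move=> x c h k; exact: (Vb x).1.
have Vr x a k : V (ract x a) k = V x (lact a k).
  apply/eqP; rewrite -subr_eq0; apply/eqP/ip_eq0.
  rewrite ipBl !ipB !Vip !inner_ract !inner_ractl !lactM.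
  by rewrite !ip_lactl !subrr.
move=> b x; apply: (total_bounded_linear_eq (lact_nondegenerate H)) => //.
  apply: (@bounded_linear_comp _ _ _ _ setT setT (V x)) => //.
  exact: bounded_linear_lact.
by move=> _ [a _ [k _ <-]]; rewrite -Vr Vc.
Qed.

Section OneRep.
Variables (F : correspondence A A) (H : representation A) (V : F -> H -> H).
Hypothesis VP : isorep V.

Lemma isorep_ip x y h k : ip (V x h) (V y k) = ip h (lact (inner x y) k).
Proof. by case: VP. Qed.

Lemma isorep_lact a x h : V (lact a x) h = lact a (V x h).
Proof. by case: VP. Qed.

Lemma nm_isorep x h : nm (V x h) = nm (x \ox h).
Proof.
apply/eqP; rewrite -(@eqrXn2 _ 2)// ?nm_ge0//; apply/eqP.
by apply: (@complexI R); rewrite -!ipxx isorep_ip ip_tens.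
Qed.

Lemma bounded_linear_isorep x : bounded_linear_on setT (V x).
Proof.
apply/bounded_linear_nm; split; first by case: VP => + _ _ _ c h k _ _; apply.
exists (2 * nm x) => [|h _]; first by rewrite mulr_ge0// nm_ge0.
by rewrite nm_isorep nm_tens.
Qed.

Lemma bounded_linear_isorepl h : bounded_linear_on setT (V^~ h).
Proof.
apply/bounded_linear_nm; split; first by case: VP => _ + _ _ c x y _ _; apply.
exists (2 * nm h) => [|x _]; first by rewrite mulr_ge0// nm_ge0.
by rewrite nm_isorep mulrAC nm_tens.
Qed.

Lemma range_tens : range (fun p : F * H => p.1 \ox p.2) =
  [set x \ox h | x in [set: F] & h in [set: H]].
Proof.
apply/seteqP; split=> [_ [[x h] _ <-]|_ [x _ [h _ <-]]]; last by exists (x, h).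
by exists x => //; exists h.
Qed.

Lemma tildeP : [/\ isometric_map (tilde (T := T) V), forall x h, tilde V (x \ox h) = V x h &
  forall a z, tilde (T := T) V (lact a z) = lact a (tilde V z)].
Proof.
have tot : Defs.total (range (fun p : F * H => p.1 \ox p.2)).
  by rewrite range_tens; exact: total_tens.
have Sext : extension (fun p : F * H => p.1 \ox p.2) (fun p => V p.1 p.2) (tilde (T := T) V).
  apply: the_operator_extension; first by rewrite [RHS]tot.
    move=> S; split=> [SP [x h]|SP x h]; [exact: SP|exact: (SP (x, h))].
  by move=> [x h] [y k] /=; rewrite isorep_ip ip_tens.
have Si := extension_isometry tot Sext; have [_ _ Sg _] := Sext.
have SE x h : tilde V (x \ox h) = V x h by exact: (Sg (x, h)).
split=> //; apply: total_lact_commute tot (proj1 Si) _.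
by move=> a _ [[x h] _ <-] /=; rewrite lact_tens !SE isorep_lact.
Qed.

End OneRep.

Section IdTensor.
Variables (F : correspondence A A) (H K : representation A) (W : set H).

Lemma tensor_subE : tensor_sub (T := T) (F := F) W =
  closure (lspan (range (fun p : F * {h | W h} => p.1 \ox sval p.2))).
Proof.
congr (closure (lspan _)); apply/seteqP; split=> [_ [x _ [h Wh <-]]|_ [[x [h Wh]] _ <-]].
  by exists (x, exist _ h Wh).
by exists x => //; exists h.
Qed.

Lemma id_tensorP (X : H -> K) :
  (forall a h, W h -> W (lact a h)) ->
  (forall a h, W h -> X (lact a h) = lact a (X h)) ->
  (forall h k, W h -> W k -> ip (X h) (X k) = ip h k) ->
  [/\ bounded_linear_on (tensor_sub (T := T) (F := F) W) (id_tensor (T := T) W X),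
      forall z w, tensor_sub (T := T) (F := F) W z -> tensor_sub (T := T) (F := F) W w ->
        ip (id_tensor (T := T) W X z) (id_tensor W X w) = ip z w &
      forall (x : F) h, W h -> id_tensor (T := T) W X (x \ox h) = x \ox X h].
Proof.
move=> Wl Xl Xi; rewrite tensor_subE.
have [Sb Si Sg _] : extension (fun p : F * {h | W h} => p.1 \ox sval p.2)
    (fun p : F * {h | W h} => p.1 \ox X (sval p.2)) (id_tensor W X).
  apply: the_operator_extension; first exact: tensor_subE.
    move=> S; split=> [SP [x [h Wh]]|SP x h Wh]; first exact: SP.
    exact: (SP (x, exist _ h Wh)).
  move=> [x [h Wh]] [y [k Wk]] /=; rewrite !ip_tens -Xl// Xi//.
  exact: Wl.
by split=> // x h Wh; exact: (Sg (x, exist _ h Wh)).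
Qed.

End IdTensor.

Lemma tensor_subT F H : tensor_sub (T := T) (F := F) [set: H] = setT.
Proof. exact: total_tens. Qed.

Lemma id_tensorTP F H K (X : H -> K) :
  isometric_map X -> (forall a h, X (lact a h) = lact a (X h)) ->
  let S := id_tensor (T := T) (F := F) setT X in
  [/\ isometric_map S, forall x h, S (x \ox h) = x \ox X h &
      forall a z, S (lact a z) = lact a (S z)].
Proof.
move=> [Xb Xi] Xl S.
have [//|//|//|] := @id_tensorP F H K setT X; rewrite tensor_subT -/S => Sb Si Sg.
have {}Sg x h : S (x \ox h) = x \ox X h by exact: Sg.
split=> //; first by split=> // x y; exact: Si.
apply: total_lact_commute (@total_tens _ T A _ F H) Sb _ => a _ [x _ [h _ <-]].
by rewrite lact_tens !Sg lact_tens.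
Qed.

Lemma tensor_idP F G H (U : F -> G) : (forall x y, inner (U x) (U y) = inner x y) ->
  forall x (h : H), tensor_id U (x \ox h) = U x \ox h.
Proof.
move=> Ui x h.
have tot : Defs.total (range (fun p : F * H => p.1 \ox p.2)).
  by rewrite range_tens; exact: total_tens.
have [_ _ Sg _] : extension (fun p : F * H => p.1 \ox p.2)
    (fun p : F * H => U p.1 \ox p.2) (tensor_id (T := T) U).
  apply: the_operator_extension; first by rewrite [RHS]tot.
    move=> S; split=> [SP [y k]|SP y k]; [exact: SP|exact: (SP (y, k))].
  by move=> [y k] [y' k'] /=; rewrite !ip_tens Ui.
exact: (Sg (x, h)).
Qed.

(** The representation of [F (x) G] given by [V] and [W]: for a product system,
    [ps_product V1 V2] is [prodrep V1 V2], and [prodrep V2 V1] is its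
    counterpart on [E2 (x) E1]. *)
Definition prodrep F G H (V : F -> H -> H) (W : G -> H -> H) : F \OX G -> H -> H :=
  fun z h => tilde V (id_tensor setT (tilde W) (tensorA (z \ox h))).

Lemma prodrepP F G H (V : F -> H -> H) (W : G -> H -> H) : isorep V -> isorep W ->
  isorep (prodrep V W) /\ forall x y h, prodrep V W (x \ox y) h = V x (W y h).
Proof.
move=> VP WP.
have [Ai AE Al] := @tensorAP _ T A F G H.
have [Wi WE Wl] := tildeP WP; have [Vi VE Vl] := tildeP VP.
have [Ii IE Il] := id_tensorTP F Wi Wl.
pose S z := tilde V (id_tensor setT (tilde W) (@tensorA R T A F G H z)).
have Si : isometric_map S by exact: isometry_comp (isometry_comp Ai Ii) Vi.
have Sl a z : S (lact a z) = lact a (S z) by rewrite /S Al Il Vl.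
split; last by move=> x y h; rewrite /prodrep AE IE VE WE.
split.
- by move=> x c h k; rewrite /prodrep tens_linearr; exact: (proj1 Si).1.
- by move=> c x y h; rewrite /prodrep tens_linearl; exact: (proj1 Si).1.
- by move=> x y h k; rewrite -(ip_tens T); exact: (proj2 Si).
- by move=> a x h; rewrite /prodrep -(lact_tens T); exact: Sl.
Qed.

End IsometricRepresentations.

(** * Wandering subspaces and purity *)

Section Wandering.
Variables (R : realType) (T : tensor_products R) (A : cstarAlgebra R).
Local Notation "F \OX G" := (tensor T F G) (at level 40, left associativity).
Local Notation "x \ox g" := (etensor T x g) (at level 40, left associativity).

Section OneRep.
Variables (F : correspondence A A) (H : representation A) (V : F -> H -> H).
Hypothesis VP : isorep V.
Local Notation W := (wandering T V).

Lemma wanderingP h : W h <-> forall x k, ip (V x k) h = 0.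
Proof.
have [[Sb Si] SE _] := tildeP T VP.
split=> [Wh x k|Wh z]; first by rewrite -SE; exact: Wh.
suff : ip h (tilde V z) = 0 by move=> e; rewrite -[LHS]/(ip _ _) ipC e conjC0.
apply: (@total_bounded_linear_eq _ (F \OX H) (cline R) _ (fun z => ip h (tilde V z)) (fun=> 0)
  (@total_tens _ T A _ F H)).
- by apply: (@bounded_linear_comp _ _ _ _ setT setT (tilde V)) => //; exact: bounded_linear_ip.
- exact: bounded_linear_cst0.
- by move=> _ [x _ [k _ <-]]; rewrite SE ipC Wh conjC0.
Qed.

Lemma wandering_sub : linear_subspace W.
Proof.
split; first by apply/wanderingP => x k; rewrite ip0.
move=> c h k /wanderingP Wh /wanderingP Wk; apply/wanderingP => x l.
by rewrite ip_linear Wh Wk mulr0 addr0.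
Qed.

Lemma wandering_closed : closure W `<=` W.
Proof.
move=> h Wh; apply/wanderingP => x k; apply: (@orth_closure_lspan _ _ W).
  by move=> w /wanderingP.
by move: Wh; apply: closureS; exact: sub_lspan.
Qed.

Lemma wandering_lact a h : W h -> W (lact a h).
Proof.
move=> /wanderingP Wh; apply/wanderingP => x k.
by rewrite ip_lact -(isorep_lact VP) Wh.
Qed.

Lemma orth_wandering u : (forall w, W w -> ip w u = 0) ->
  (forall x k, ip (V x k) u = 0) -> u = 0.
Proof. by move=> uW /wanderingP/uW /ip_eq0. Qed.

Lemma bounded_linear_word s : bounded_linear_on setT (fun h => foldr V h s).
Proof.
elim: s => [|x s IHs] /=.
  by split=> //; exists 1 => h _; rewrite mul1r.
apply: (@bounded_linear_comp _ _ _ _ setT setT (fun h => foldr V h s)) => //.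
exact: (bounded_linear_isorep T VP).
Qed.

Lemma lact_word a s z h : lact a (foldr V h (z :: s)) = foldr V h (lact a z :: s).
Proof. by rewrite /= isorep_lact. Qed.

(** Stripping the first letters of both words leaves an inner product of a
    vector of [W] with a vector of the range of [V]. *)
Lemma orth_word s s' w k : W w -> (size s < size s')%N ->
  ip (foldr V w s) (foldr V k s') = 0.
Proof.
move=> Ww; elim: s s' => [|x s IHs] [|z s'] //=.
  by move=> _; rewrite ipC (proj1 (wanderingP w) Ww) conjC0.
rewrite ltnS (isorep_ip VP); case: s' => [|z' s'] // ss'.
by rewrite lact_word IHs.
Qed.

Lemma VprodE n x h : Vprod V n x h = foldr V h (mkseq x n.+1).
Proof.
elim: n x => [|n IHn] x //.
rewrite /mkseq -[iota 0 n.+2]/(0%N :: iota (1 + 0) n.+1) iotaDl map_cons -map_comp.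
by rewrite -[LHS]/(V (x 0%N) (Vprod V n (fun i => x i.+1) h)) IHn.
Qed.

Lemma word_Vprod n s h : size s = n.+1 -> foldr V h s = Vprod V n (nth 0 s) h.
Proof. by move=> sn; rewrite VprodE -sn mkseq_nth. Qed.

Lemma lact_etpow n (x : nat -> F) a :
  lact a (etpow T n x) = etpow T n (fun i => if i is 0%N then lact a (x 0%N) else x i).
Proof. by case: n => [|n] //=; rewrite lact_tens. Qed.

Lemma lact_Vprod n (x : nat -> F) a h :
  lact a (Vprod V n x h) = Vprod V n (fun i => if i is 0%N then lact a (x 0%N) else x i) h.
Proof. by case: n => [|n] /=; rewrite isorep_lact. Qed.

Lemma ip_Vprod n (x y : nat -> F) h k :
  ip (Vprod V n x h) (Vprod V n y k) = ip h (lact (inner (etpow T n x) (etpow T n y)) k).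
Proof.
elim: n x y k => [|n IHn] x y k /=; first exact: isorep_ip.
rewrite (isorep_ip VP) lact_Vprod IHn.
by rewrite [inner (_ \ox _) _](tens_inner (T F (tpow T F n))) lact_etpow.
Qed.

End OneRep.

(** The induction goes through the associativity isometry, since elementary
    tensors are continuous in each variable when the last factor is a Hilbert
    space. *)
Lemma total_etpow (F : correspondence A A) (H : representation A) n :
  Defs.total (range (fun p : (nat -> F) * H => etpow T n p.1 \ox p.2)).
Proof.
apply/totalP; elim: n => [|n IHn] u uP.
  apply: (proj1 (totalP _) (@total_tens _ T A _ F H)) => _ [x _ [h _ <-]].
  by apply: uP; exists (fun=> x, h).
have [[Sb Si] SE _] := @tensorAP _ T A F (tpow T F n) H.
apply: ip_eq0; rewrite -Si; suff -> : tensorA u = 0 by rewrite ip0.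
apply: (proj1 (totalP _) (total_tensr T F (proj2 (totalP _) IHn))).
move=> _ [x _ [_ [[y h] _ <-] <-]] /=.
rewrite -SE Si; apply: uP.
by exists (fun i => if i is i'.+1 then y i' else x, h).
Qed.

Section Pure.
Variables (F : correspondence A A) (H : representation A) (V : F -> H -> H).
Hypothesis VP : isorep V.
Local Notation W := (wandering T V).

Lemma tilde_powP n : isometric_map (tilde_pow (T := T) V (n := n)) /\
  forall x h, tilde_pow V (etpow T n x \ox h) = Vprod V n x h.
Proof.
have tot := @total_etpow F H n.
have Sext : extension (fun p : (nat -> F) * H => etpow T n p.1 \ox p.2)
    (fun p => Vprod V n p.1 p.2) (tilde_pow (T := T) V (n := n)).
  apply: the_operator_extension; first by rewrite [RHS]tot.
    move=> S; split=> [SP [x h]|SP x h]; [exact: SP|exact: (SP (x, h))].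
  by move=> [x h] [y k] /=; rewrite (ip_Vprod VP) ip_tens.
split; first exact: extension_isometry tot Sext.
by case: Sext => _ _ Sg _ x h; exact: (Sg (x, h)).
Qed.

(** The Wold decomposition of a pure representation: [H] is the closed span of
    the words applied to the wandering subspace.  If [u] is orthogonal to all
    of these, then so is [g = u - P u], where [P] projects onto the closed span
    of the words of length [n + 1] applied to [H]; as [g] is also orthogonal to
    the latter words, it is by descending induction on the length orthogonal to
    all words applied to [H], and in particular to itself.  Hence [u = P u] for
    all [n], and this tends to 0. *)
Lemma pure_total : pure T V ->
  Defs.total (range (fun p : seq F * {w | W w} => foldr V (sval p.2) p.1)).
Proof.
move=> pV; apply/totalP => u uP.
have uW s w : W w -> ip (foldr V w s) u = 0.
  by move=> Ww; apply: uP; exists (s, exist _ w Ww).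
(* [tilde_pow V] at [n] lives on the (n + 1)-st tensor power *)
suff fixed n : tilde_pow V (adjoint (tilde_pow (T := T) V (n := n)) u) = u.
  have /cvg_nmP pu := pV u; apply: nm_small => e /pu[N /(_ N (leqnn N))].
  by rewrite fixed sub0r nmN => /ltW.
set S := tilde_pow V (n := n); have [[Sb Si] SE] := tilde_powP n; rewrite -/S in Sb Si SE.
apply/eqP; rewrite eq_sym -subr_eq0; apply/eqP; set g := u - _.
have gn s k : size s = n.+1 -> ip (foldr V k s) g = 0.
  move=> /(word_Vprod V k) ->; rewrite -SE ipB Si.
  by rewrite (adjoint_exists Sb) subrr.
have gW s w : W w -> (size s < n.+1)%N -> ip (foldr V w s) g = 0.
  move=> Ww sn; rewrite ipB uW// sub0r; apply/eqP; rewrite oppr_eq0; apply/eqP.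
  move: (adjoint S u) => z.
  apply: (@total_bounded_linear_eq _ _ (cline R) _ (fun z => ip (foldr V w s) (S z)) (fun=> 0)
    (@total_etpow F H n)).
  - by apply: (@bounded_linear_comp _ _ _ _ setT setT S) => //; exact: bounded_linear_ip.
  - exact: bounded_linear_cst0.
  - by move=> _ [[x k] _ <-] /=; rewrite SE VprodE (orth_word VP)// size_mkseq.
have desc j : (j <= n.+1)%N -> forall s k, size s = (n.+1 - j)%N -> ip (foldr V k s) g = 0.
  elim: j => [_ s k|j IHj jn s k sj]; first by rewrite subn0; exact: gn.
  have sn : (size s < n.+1)%N by rewrite sj ltn_subrL.
  rewrite (adjoint_exists (bounded_linear_word VP s)).
  suff -> : adjoint (foldr V ^~ s) g = 0 by rewrite ip0.
  apply: (orth_wandering VP) => [w Ww|x l];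
    rewrite -(adjoint_exists (bounded_linear_word VP s)); first exact: gW.
  rewrite -foldr_rcons; apply: IHj; first exact: ltnW.
  by rewrite size_rcons sj -subSn.
by apply: ip_eq0; apply: (desc n.+1 (leqnn _) [::]); rewrite subnn.
Qed.

End Pure.

Section Unitary.
Variables (F : correspondence A A) (H H' : representation A).
Variables (V : F -> H -> H) (V' : F -> H' -> H') (X : H -> H').
Hypotheses (VP : isorep V) (V'P : isorep V').
Local Notation W := (wandering T V).
Local Notation W' := (wandering T V').
Hypothesis XW : forall w, W w -> W' (X w).
Hypothesis Xi : forall w w', W w -> W w' -> ip (X w) (X w') = ip w w'.
Hypothesis Xl : forall a w, W w -> X (lact a w) = lact a (X w).

(** The inner product of two words reduces, by stripping letters, to an inner
    product of two vectors of [W], or to 0 if the lengths differ; the operators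
    [lact a] that appear are absorbed by the next letter, or by [W] when no
    letter is left. *)
Lemma ip_word s s' w w' : W w -> W w' ->
  ip (foldr V' (X w) s) (foldr V' (X w') s') = ip (foldr V w s) (foldr V w' s').
Proof.
move=> Ww; elim: s s' w' => [|x s IHs] [|z s'] w' Ww'.
- exact: Xi.
- by rewrite (orth_word V'P (s := [::]))// ?(orth_word VP (s := [::]))//; exact: XW.
- rewrite ipC [RHS]ipC (orth_word V'P (s := [::]))//; last exact: XW.
  by rewrite (orth_word VP (s := [::])).
rewrite /= (isorep_ip V'P) (isorep_ip VP); case: s' => [|z' s'].
  by rewrite /= -Xl// (IHs [::])//; exact: wandering_lact.
by rewrite !lact_word// IHs.
Qed.

(** [U] maps a word applied to [w] to the same word, for [V'], applied to [X w].
    By [ip_word] this preserves inner products, and by purity both families of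
    vectors are total. *)
Lemma wandering_extension : X @` W = W' -> pure T V -> pure T V' ->
  exists U : H -> H', [/\ unitary_on setT setT U, isometric_map U,
    (forall w, W w -> U w = X w),
    forall a h, U (lact a h) = lact a (U h) & forall z h, U (V z h) = V' z (U h)].
Proof.
move=> XWE pV pV'.
pose g (p : seq F * {w | W w}) := foldr V (sval p.2) p.1.
pose f (p : seq F * {w | W w}) := foldr V' (X (sval p.2)) p.1.
have gtot : Defs.total (range g) by exact: pure_total.
have ftot : Defs.total (range f).
  rewrite (_ : range f = range (fun p : seq F * {w | W' w} => foldr V' (sval p.2) p.1)).
    exact: pure_total.
  apply/seteqP; split=> [_ [[s [w Ww]] _ <-]|_ [[s [w' Ww']] _ <-]].
    by exists (s, exist _ (X w) (XW Ww)).
  have : (X @` W) w' by rewrite XWE.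
  by case=> w Ww wE; exists (s, exist _ w Ww) => //; rewrite /f /= wE.
have [U Uext] : exists U, extension g f U.
  apply: extension_exists => -[s [w Ww]] [s' [w' Ww']]; exact: ip_word.
have Ui := extension_isometry gtot Uext; have [_ _ Ug UT] := Uext.
have {}Ug s w : W w -> U (foldr V w s) = foldr V' (X w) s.
  by move=> Ww; exact: (Ug (s, exist _ w Ww)).
exists U; split => //.
- split; [exact: (proj1 Ui).1|by move=> x y _ _; exact: (proj2 Ui)|].
  by move: UT; rewrite gtot ftot.
- by move=> w Ww; exact: (Ug [::]).
- apply: total_lact_commute gtot (proj1 Ui) _ => a _ [[s [w Ww]] _ <-].
  rewrite /g /= Ug//; case: s => [|z s]; last by rewrite !lact_word// Ug.
  by rewrite /= (Ug [::]) ?Xl//; exact: wandering_lact.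
- move=> z; apply: (total_bounded_linear_eq gtot).
  + by apply: (@bounded_linear_comp _ _ _ _ setT setT (V z)) => //;
      [exact: (bounded_linear_isorep T VP)|exact: (proj1 Ui)].
  + by apply: (@bounded_linear_comp _ _ _ _ setT setT U) => //;
      [exact: (proj1 Ui)|exact: (bounded_linear_isorep T V'P)].
  + move=> _ [[s [w Ww]] _ <-]; rewrite /g /= Ug// -[V z _]/(foldr V w (z :: s)).
    by rewrite Ug.
Qed.

End Unitary.
End Wandering.

(** * Pairs of isometric representations *)

Section Pairs.
Variables (R : realType) (T : tensor_products R) (A : cstarAlgebra R).
Local Notation "F \OX G" := (tensor T F G) (at level 40, left associativity).
Local Notation "x \ox g" := (etensor T x g) (at level 40, left associativity).
Local Notation prodrep := (prodrep (T := T)).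
Local Notation wandering := (wandering T).

Section WanderingOfProduct.
Variables (F G : correspondence A A) (H : representation A).
Variables (V1 : F -> H -> H) (V2 : G -> H -> H).
Hypotheses (V1P : isorep V1) (V2P : isorep V2).
Local Notation W := (wandering (prodrep V1 V2)).

Lemma wandering_prodP h : W h <-> forall x y k, ip (V1 x (V2 y k)) h = 0.
Proof.
have [VP VE] := prodrepP T V1P V2P; split=> [/(wanderingP T VP) Wh x y k|Wh].
  by rewrite -VE.
apply/(wanderingP T VP) => z k; rewrite ipC.
suff -> : ip h (prodrep V1 V2 z k) = 0 by rewrite conjC0.
apply: (@total_bounded_linear_eq _ (F \OX G) (cline R) _
  (fun z => ip h (prodrep V1 V2 z k)) (fun=> 0) (@total_tens _ T A _ F G)).
- apply: (@bounded_linear_comp _ _ _ _ setT setT ((prodrep V1 V2)^~ k)) => //.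
    exact: (bounded_linear_isorepl T VP).
  exact: bounded_linear_ip.
- exact: bounded_linear_cst0.
- by move=> _ [x _ [y _ <-]]; rewrite VE ipC Wh conjC0.
Qed.

Lemma wandering_prod_left w : wandering V1 w -> W w.
Proof. by move=> /(wanderingP T V1P) w1; apply/wandering_prodP => x y k. Qed.

Lemma wandering_prod_right x w : wandering V2 w -> W (V1 x w).
Proof.
move=> w2; apply/wandering_prodP => x' y k; rewrite (isorep_ip V1P).
by rewrite (proj1 (wanderingP T V2P _) (wandering_lact V2P _ w2)).
Qed.

(** A vector [u] of [W] orthogonal to [V1 x W2] has [(V1 x)^* u] in [W2], hence
    [(V1 x)^* u = 0], so that [u] is in [W1]. *)
Lemma wandering_prod_span :
  W `<=` closure (lspan (wandering V1 `|` [set V1 x w | x in setT & w in wandering V2])).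
Proof.
have [VP VE] := prodrepP T V1P V2P.
apply: (closure_lspan_orth (wandering_sub T VP) (wandering_closed VP)).
  by move=> v [v1|[x _ [w w2 <-]]];
    [exact: wandering_prod_left|exact: wandering_prod_right].
move=> u /wandering_prodP Wu uS.
apply: (orth_wandering V1P) => [w w1|x k]; first by apply: uS; left.
have adj := adjoint_exists (bounded_linear_isorep T V1P x).
rewrite adj; suff -> : adjoint (V1 x) u = 0 by rewrite ip0.
have v2 : wandering V2 (adjoint (V1 x) u).
  by apply/(wanderingP T V2P) => y l; rewrite -adj.
by apply: ip_eq0; rewrite -adj; apply: uS; right; exists x => //; exists (adjoint (V1 x) u).
Qed.

End WanderingOfProduct.

Section Intertwining.
Variables (F G : correspondence A A) (H H' : representation A).
Variables (V1 : F -> H -> H) (V2 : G -> H -> H).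
Variables (V1' : F -> H' -> H') (V2' : G -> H' -> H') (U : H -> H').
Hypotheses (V1P : isorep V1) (V2P : isorep V2) (V1P' : isorep V1') (V2P' : isorep V2').
Hypothesis Ub : bounded_linear_on setT U.
Hypothesis UV12 : forall z h, U (prodrep V1 V2 z h) = prodrep V1' V2' z (U h).

(** [prodrep V2 V1] has a wandering subspace spanned by that of [V2] and by the
    [V2 y w] with [w] wandering for [V1]. On the latter vectors,
    [V1 x (V2 y w)] is the product representation at [x (x) y], for which the
    intertwining relation is known. *)
Lemma intertwine_wandering :
  (forall x w, wandering V2 w -> U (V1 x w) = V1' x (U w)) ->
  (forall y w, wandering V1 w -> U (V2 y w) = V2' y (U w)) ->
  forall x w, wandering (prodrep V2 V1) w -> U (V1 x w) = V1' x (U w).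
Proof.
move=> U1 U2 x w /(wandering_prod_span V2P V1P) Ww.
have V12 := (prodrepP T V1P V2P).2; have V12' := (prodrepP T V1P' V2P').2.
set S := _ `|` _ in Ww.
apply: (@bounded_linear_eq _ _ _ (closure (lspan S)) S
  (fun h => U (V1 x h)) (fun h => V1' x (U h))) Ww => //.
- exact: sub_closure_lspan.
- exact: closure_lspan_subspace.
- apply: (@bounded_linear_sub _ _ _ _ setT) => //.
  apply: (@bounded_linear_comp _ _ _ _ setT setT (V1 x)) => //.
  exact: (bounded_linear_isorep T V1P).
- apply: (@bounded_linear_sub _ _ _ _ setT) => //.
  apply: (@bounded_linear_comp _ _ _ _ setT setT U) => //.
  exact: (bounded_linear_isorep T V1P').
- move=> v [v2|[y _ [w' w1 <-]]]; first exact: U1.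
  by rewrite -V12 UV12 V12' U2.
Qed.

(** On elementary tensors, [V1 x V2 y V1 x' g] is [prodrep V1 V2 (x (x) y)]
    applied to [V1 x' g], for which the relation is assumed. *)
Lemma intertwine_step g : (forall t h, U (prodrep V2 V1 t h) = prodrep V2' V1' t (U h)) ->
  (forall x, U (V1 x g) = V1' x (U g)) ->
  forall t x, U (V1 x (prodrep V2 V1 t g)) = V1' x (U (prodrep V2 V1 t g)).
Proof.
move=> UV21 Ug t x.
have [V21P V21] := prodrepP T V2P V1P; have [_ V21'] := prodrepP T V2P' V1P'.
have V12 := (prodrepP T V1P V2P).2; have V12' := (prodrepP T V1P' V2P').2.
have Vb := bounded_linear_isorepl T V21P g.
apply: (@total_bounded_linear_eq _ (G \OX F) _ _ (fun t => U (V1 x (prodrep V2 V1 t g)))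
  (fun t => V1' x (U (prodrep V2 V1 t g))) (@total_tens _ T A _ G F)).
- apply: (@bounded_linear_comp _ _ _ _ setT setT ((prodrep V2 V1)^~ g) (U \o V1 x)) => //.
  apply: (@bounded_linear_comp _ _ _ _ setT setT (V1 x)) => //.
  exact: (bounded_linear_isorep T V1P).
- apply: (@bounded_linear_comp _ _ _ _ setT setT ((prodrep V2 V1)^~ g) (V1' x \o U)) => //.
  apply: (@bounded_linear_comp _ _ _ _ setT setT U) => //.
  exact: (bounded_linear_isorep T V1P').
- move=> _ [y _ [x' _ <-]].
  by rewrite UV21 V21 V21' -V12 UV12 V12' Ug.
Qed.

End Intertwining.

Section IdTensorIntertwines.
Variables (F : correspondence A A) (H H' : representation A).
Variables (V : F -> H -> H) (V' : F -> H' -> H') (X : H -> H') (W D : set H).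
Hypotheses (VP : isorep V) (V'P : isorep V').
Hypothesis Wl : forall a h, W h -> W (lact a h).
Hypothesis Xl : forall a h, W h -> X (lact a h) = lact a (X h).
Hypothesis Xi : forall h k, W h -> W k -> ip (X h) (X k) = ip h k.
Hypothesis DW : D `<=` W.

Lemma tensor_subS : tensor_sub (T := T) (F := F) D `<=` tensor_sub W.
Proof. by apply: closure_lspanS => _ [x _ [h /DW Wh <-]]; exists x => //; exists h. Qed.

Lemma sub_tensor_sub (x : F) h : D h -> tensor_sub (T := T) D (x \ox h).
Proof. by move=> Dh; apply: sub_closure_lspan; exists x => //; exists h. Qed.

Lemma id_tensor_intertwine : bounded_linear_on setT X ->
  (forall x h, D h -> V' x (X h) = X (V x h)) ->
  forall z, tensor_sub D z -> X (tilde V z) = tilde V' (id_tensor (T := T) W X z).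
Proof.
move=> Xb XV z Dz.
have [[Vb _] VE _] := tildeP T VP; have [[Vb' _] VE' _] := tildeP T V'P.
have [Ib _ IE] := @id_tensorP _ T A F H H' W X Wl Xl Xi.
apply: (@bounded_linear_eq _ _ _ (tensor_sub D) [set x \ox h | x in [set: F] & h in D]
  (fun z => X (tilde V z)) (fun z => tilde V' (id_tensor W X z))) Dz => //.
- exact: sub_closure_lspan.
- exact: closure_lspan_subspace.
- apply: (@bounded_linear_sub _ _ _ _ setT) => //.
  exact: (@bounded_linear_comp _ _ _ _ setT setT (tilde V)).
- apply: (@bounded_linear_comp _ _ _ _ _ setT (id_tensor W X)) => //.
  by apply: bounded_linear_sub Ib; exact: tensor_subS.
- move=> _ [x _ [h Dh <-]].
  by rewrite VE IE ?VE' ?XV//; exact: DW.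
Qed.

Lemma id_tensor_sub (D' : set H') : (forall h, D h -> D' (X h)) ->
  forall z, tensor_sub D z -> tensor_sub D' (id_tensor (T := T) (F := F) W X z).
Proof.
move=> DD' z Dz; have [Ib _ IE] := @id_tensorP _ T A F H H' W X Wl Xl Xi.
rewrite /tensor_sub.
apply: (@bounded_linear_closure _ _ _ (tensor_sub W) [set x \ox h | x in [set: F] & h in D]) => //.
- by move=> _ [x _ [h Dh <-]]; apply/tensor_subS/sub_tensor_sub.
- exact: closure_lspan_subspace.
- exact: linear_subspace_lspan.
- move=> _ [x _ [h Dh <-]]; apply: sub_lspan.
  by rewrite IE; [exists x => //; exists (X h) => //; exact: DD'|exact: DW].
- exact: tensor_subS.
Qed.

End IdTensorIntertwines.
End Pairs.

Section ProductSystem.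
Variables (R : realType) (T : tensor_products R) (A : cstarAlgebra R).
Variable E : product_system T A.
Local Notation E1 := (ps1 E).
Local Notation E2 := (ps2 E).

Lemma inner_t12 x y : inner (@t12 _ _ _ E x) (t12 y) = inner x y.
Proof.
have [_ ti _ _] := t21_unitary E.
by rewrite -ti !t12K.
Qed.

Lemma ps_isometricP (H : representation A) (V1 : E1 -> H -> H) (V2 : E2 -> H -> H) :
  ps_isometric V1 V2 -> [/\ isorep V1, isorep V2 &
    forall z h, prodrep V1 V2 z h = prodrep V2 V1 (t12 z) h].
Proof.
move=> [[cV1 cV2 comm] iV1 iV2].
split; [exact: covariant_isorep|exact: covariant_isorep|move=> z h].
by rewrite {1}/prodrep comm tensor_idP//; exact: inner_t12.
Qed.

Variables (H H' : representation A).
Variables (V1 : E1 -> H -> H) (V2 : E2 -> H -> H).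
Variables (V1' : E1 -> H' -> H') (V2' : E2 -> H' -> H').
Hypotheses (isoV : ps_isometric V1 V2) (isoV' : ps_isometric V1' V2').
Local Notation W := (wandering T (ps_product V1 V2)).
Local Notation W' := (wandering T (ps_product V1' V2')).

Lemma prodrep_swap (K : representation A) (S1 : E1 -> K -> K) (S2 : E2 -> K -> K) :
  ps_isometric S1 S2 -> forall t h, prodrep S2 S1 t h = prodrep S1 S2 (t21 t) h.
Proof. by move=> /ps_isometricP[_ _ comm] t h; rewrite comm t21K. Qed.

Lemma wandering_swap : W = wandering T (prodrep (T := T) V2 V1).
Proof.
have [V1P V2P comm] := ps_isometricP isoV.
have [V12P _] := prodrepP T V1P V2P; have [V21P _] := prodrepP T V2P V1P.
apply/seteqP; split=> w Ww.
  apply/(wanderingP T V21P) => t k; rewrite (prodrep_swap isoV).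
  exact: (proj1 (wanderingP T V12P w) Ww).
apply/(wanderingP T V12P) => t k; rewrite comm.
exact: (proj1 (wanderingP T V21P w) Ww).
Qed.

Lemma wandering1_sub : wandering T V1 `<=` W.
Proof.
have [V1P V2P _] := ps_isometricP isoV.
by move=> w; exact: wandering_prod_left.
Qed.

Lemma wandering2_sub : wandering T V2 `<=` W.
Proof.
have [V1P V2P _] := ps_isometricP isoV.
by rewrite wandering_swap => w; exact: wandering_prod_left.
Qed.

Lemma wandering_ps_lact a w : W w -> W (lact a w).
Proof.
have [V1P V2P _] := ps_isometricP isoV.
by apply: wandering_lact; case: (prodrepP T V1P V2P).
Qed.

Lemma ps_isomorphic_wandering :
  ps_isomorphic V1 V2 V1' V2' -> wandering_isomorphic V1 V2 V1' V2'.
Proof.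
have [V1P V2P _] := ps_isometricP isoV; have [V1P' V2P' _] := ps_isometricP isoV'.
move=> [U [[Ul Ui UT] Ulact UV1 UV2]].
have Uip x y : ip (U x) (U y) = ip x y by exact: Ui.
have Ub : bounded_linear_on setT U.
  apply: bounded_linear_isometry => // x _; apply/eqP.
  rewrite -(@eqrXn2 _ 2)// ?nm_ge0//; apply/eqP/(@complexI R).
  by rewrite -!ipxx Uip.
have Usurj k' : exists k, U k = k'.
  by have [k _ <-] : (U @` setT) k' by [rewrite UT]; exists k.
have UW1 w : wandering T V1 w -> wandering T V1' (U w).
  move=> /(wanderingP T V1P) w1; apply/(wanderingP T V1P') => x k'.
  by have [k <-] := Usurj k'; rewrite UV1 Uip.
have UW2 w : wandering T V2 w -> wandering T V2' (U w).
  move=> /(wanderingP T V2P) w2; apply/(wanderingP T V2P') => y k'.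
  by have [k <-] := Usurj k'; rewrite UV2 Uip.
have Utilde2 z : tensor_sub (T := T) (wandering T V1) z ->
    U (tilde V2 z) = tilde V2' (id_tensor W U z).
  by apply: id_tensor_intertwine => //; [exact: wandering_ps_lact|exact: wandering1_sub].
have Utilde1 z : tensor_sub (T := T) (wandering T V2) z ->
    U (tilde V1 z) = tilde V1' (id_tensor W U z).
  by apply: id_tensor_intertwine => //; [exact: wandering_ps_lact|exact: wandering2_sub].
exists U; split => //.
- split=> [c x y _ _|x y _ _|]; [exact: Ul|exact: Ui|].
  apply/seteqP; split=> [_ [w /(wandering_prodP T V1P V2P) Ww <-]|w' Ww'].
    apply/(wandering_prodP T V1P' V2P') => x y k'.
    by have [k <-] := Usurj k'; rewrite UV2 UV1 Uip.
  have [w wE] := Usurj w'.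
  exists w => //; apply/(wandering_prodP T V1P V2P) => x y k.
  rewrite -Uip wE -UV1 -UV2.
  exact: (proj1 (wandering_prodP T V1P' V2P' w') Ww').
- split=> [_ [_ [z z1 <-] <-]|_ [w w2 <-]]; last exact: UW2.
  rewrite Utilde2//; exists (id_tensor W U z) => //.
  by apply: id_tensor_sub z1 => //; [exact: wandering_ps_lact|exact: wandering1_sub].
- have [S2i _ _] := tildeP T V2P; have [S2i' _ _] := tildeP T V2P'.
  by move=> _ [z z1 <-]; rewrite (adjointK S2i) Utilde2// (adjointK S2i').
Qed.

Lemma wandering_isomorphic_ps : ps_pure V1 V2 -> ps_pure V1' V2' ->
  wandering_isomorphic V1 V2 V1' V2' -> ps_isomorphic V1 V2 V1' V2'.
Proof.
have [V1P V2P comm] := ps_isometricP isoV; have [V1P' V2P' _] := ps_isometricP isoV'.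
have [V12P _] := prodrepP T V1P V2P; have [V12P' _] := prodrepP T V1P' V2P'.
have [S1i S1E _] := tildeP T V1P; have [S2i S2E _] := tildeP T V2P.
have [S1i' S1E' _] := tildeP T V1P'; have [S2i' S2E' _] := tildeP T V2P'.
move=> pureV pureV' [X [[Xlin Xi XW] [XZ _] Xl X3 X4]].
have XW' w : W w -> W' (X w).
  by move=> Ww; have : (X @` W) (X w) by [exists w]; rewrite XW.
have [U [Uu [Ub Ui] UX Ul UV12]] :=
  wandering_extension V12P V12P' XW' Xi Xl XW pureV pureV'.
have UV21 t h : U (prodrep (T := T) V2 V1 t h) = prodrep V2' V1' t (U h).
  by rewrite (prodrep_swap isoV) UV12 (prodrep_swap isoV').
have U1 x w : wandering T V2 w -> U (V1 x w) = V1' x (U w).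
  move=> w2; have Ww := wandering2_sub w2.
  rewrite !UX//; last exact: wandering_prod_right.
  have [_ _ IE1] := @id_tensorP _ T A E1 H H' _ X wandering_ps_lact Xl Xi.
  by have := X4 (etensor T x w) (sub_tensor_sub w2); rewrite S1E IE1 ?S1E'.
have U2 y w : wandering T V1 w -> U (V2 y w) = V2' y (U w).
  move=> w1; have Ww := wandering1_sub w1.
  rewrite !UX//; last by rewrite wandering_swap; exact: wandering_prod_right.
  have Zw : (tilde (T := T) V2 @` tensor_sub (wandering T V1)) (V2 y w).
    by exists (etensor T y w); [exact: sub_tensor_sub|exact: S2E].
  have [z' z1' z'E] := XZ _ (ex_intro2 _ _ _ Zw erefl).
  have [_ _ IE2] := @id_tensorP _ T A E2 H H' _ X wandering_ps_lact Xl Xi.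
  have := X3 _ Zw; rewrite -{1}S2E (adjointK S2i) IE2// -z'E (adjointK S2i').
  by move=> <-; rewrite S2E'.
exists U; split=> //.
- move=> x h; apply/esym; move: h.
  apply: (total_bounded_linear_eq (pure_total V12P pureV)).
  + apply: (@bounded_linear_comp _ _ _ _ setT setT (V1 x)) => //.
    exact: (bounded_linear_isorep T V1P).
  + apply: (@bounded_linear_comp _ _ _ _ setT setT U) => //.
    exact: (bounded_linear_isorep T V1P').
  move=> _ [[s [w Ww]] _ <-] /=; elim: s x => [|z s IHs] x /=.
    apply: (intertwine_wandering V1P V2P V1P' V2P' Ub UV12 U1 U2).
    by rewrite -wandering_swap.
  rewrite comm.
  exact: (intertwine_step V1P V2P V1P' V2P').
- move=> y h; apply/esym; move: h.
  apply: (total_bounded_linear_eq (pure_total V12P pureV)).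
  + apply: (@bounded_linear_comp _ _ _ _ setT setT (V2 y)) => //.
    exact: (bounded_linear_isorep T V2P).
  + apply: (@bounded_linear_comp _ _ _ _ setT setT U) => //.
    exact: (bounded_linear_isorep T V2P').
  move=> _ [[s [w Ww]] _ <-] /=; elim: s y => [|z s IHs] y /=.
    exact: (intertwine_wandering V2P V1P V2P' V1P' Ub UV21 U2 U1).
  exact: (intertwine_step V2P V1P V2P' V1P').
Qed.

End ProductSystem.

Theorem theorem2p7 (R : realType) (T : tensor_products R) (A : cstarAlgebra R)
    (E : product_system T A) (H H' : representation A)
    (V1 : ps1 E -> H -> H) (V2 : ps2 E -> H -> H)
    (V1' : ps1 E -> H' -> H') (V2' : ps2 E -> H' -> H')
    (isoV : ps_isometric V1 V2) (pureV : ps_pure V1 V2)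
    (isoV' : ps_isometric V1' V2') (pureV' : ps_pure V1' V2') :
  ps_isomorphic V1 V2 V1' V2' <-> wandering_isomorphic V1 V2 V1' V2'.
Proof.
split; first exact: ps_isomorphic_wandering.
exact: wandering_isomorphic_ps.
Qed.
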